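(* Let $r$ be a positive integer, let $G$ be a graph with odd girth at least $11$, and let $X\subseteq V(G)$ satisfy $\chi(G[X])\ge 6^{r+1}+\frac{34}{5}(6^r-1)-1$. Then $G$ contains an $r$-arithmetic rope all of whose vertices lie in $X$; that is, there are vertices $q_1,\dots,q_r\in X$ and paths $Q_{i,1},Q_{i,2}$ ($1\le i\le r$) in $G[X]$ such that, with indices taken modulo $r$: for every $i$, $Q_{i,1}$ is a path of odd length and $Q_{i,2}$ a path of even length between $q_i$ and $q_{i+1}$; for every $(h_1,\dots,h_r)\in\{1,2\}^r$, the graph $Q_{1,h_1}\cup\cdots\cup Q_{r,h_r}$ is an induced cycle of $G$; and the vertices $q_1,\dots,q_r$ are pairwise at distance at least $5$ in $G$.
   Context: All graphs are finite and simple. The odd girth of a graph is the length of a shortest odd cycle ($\infty$ if none). $\chi(G[X])$ is the chromatic number of the subgraph of $G$ induced by $X$. The length of a path is its number of edges. *)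

(* Defs.v *)
From HB Require Import structures.
From mathcomp Require Import all_boot all_order all_algebra.

Set Implicit Arguments.
Unset Strict Implicit.
Unset Printing Implicit Defensive.

Record sgraph := SGraph {
  svertex :> finType;
  sedge : rel svertex;
  sedge_sym : symmetric sedge;
  sedge_irrefl : irreflexive sedge }.

Section Induced.
Variables (G : sgraph) (X : {set G}).

Definition induced_edge : rel {x : G | x \in X} :=
  fun u v => sedge (val u) (val v).

Lemma induced_edge_sym : symmetric induced_edge.
Proof. by move=> u v; apply: sedge_sym. Qed.

Lemma induced_edge_irrefl : irreflexive induced_edge.
Proof. by move=> u; apply: sedge_irrefl. Qed.

Definition induced : sgraph := SGraph induced_edge_sym induced_edge_irrefl.
End Induced.

Definition colorable (G : sgraph) (k : nat) : bool :=
  [exists f : {ffun G -> 'I_k},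
    [forall x, forall y, sedge x y ==> (f x != f y)]].

Lemma colorable_exists (G : sgraph) : exists k, colorable G k.
Proof.
exists #|G|; apply/existsP; exists [ffun x => enum_rank x].
apply/forallP => x; apply/forallP => y; apply/implyP => exy.
rewrite !ffunE; apply/eqP => /enum_rank_inj eq_xy.
by rewrite eq_xy sedge_irrefl in exy.
Qed.

Definition chi (G : sgraph) : nat := ex_minn (colorable_exists G).

Definition is_cycle (G : sgraph) (c : seq G) : bool :=
  (2 < size c) && ucycleb (@sedge G) c.

(* Holds for every k when there is no odd cycle (odd girth infinite). *)
Definition odd_girth_at_least (G : sgraph) (k : nat) : Prop :=
  forall c : seq G, is_cycle c -> odd (size c) -> k <= size c.

(* The path is x :: p, so its length is size p.  For x != y this is a path in  *)
(* the usual sense.  For x = y it is a closed path (only the two ends          *)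
(* coincide); in a rope this happens exactly when r = 1, where q_1 and q_2     *)
(* are the same vertex and each Q_(1,h) has to be a cycle through it.          *)
Definition is_path (G : sgraph) (x : G) (p : seq G) (y : G) : bool :=
  [&& path (@sedge G) x p, last x p == y &
      if x == y then uniq p else uniq (x :: p)].

(* Holds for every d when x and y are not connected (distance infinite). *)
Definition dist_at_least (G : sgraph) (d : nat) (x y : G) : Prop :=
  forall p : seq G, is_path x p y -> d <= size p.

(* Subgraphs: a vertex set and a set of edges, an edge being the set of its    *)
(* two ends.                                                                   *)
Record subgraph (G : sgraph) := Subgraph {
  sub_vertices : {set G};
  sub_edges : {set {set G}} }.

Definition path_graph (G : sgraph) (x : G) (p : seq G) : subgraph G :=
  Subgraph [set z in x :: p]
           [set [set uv.1; uv.2] | uv in zip (x :: p) p].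

Definition cycle_graph (G : sgraph) (c : seq G) : subgraph G :=
  Subgraph [set z in c] [set [set z; next c z] | z in c].

Definition union_graph (G : sgraph) (I : finType) (H : I -> subgraph G) :
    subgraph G :=
  Subgraph (\bigcup_i sub_vertices (H i)) (\bigcup_i sub_edges (H i)).

Definition is_induced (G : sgraph) (H : subgraph G) : Prop :=
  sub_edges H =
  [set [set x; y] | x in sub_vertices H, y in sub_vertices H & sedge x y].

Definition is_induced_cycle (G : sgraph) (H : subgraph G) : Prop :=
  (exists2 c : seq G, is_cycle c & H = cycle_graph c) /\ is_induced H.

(* Q i true and Q i false stand for Q_(i,1) (odd) and Q_(i,2) (even), each     *)
(* listed without its first vertex q i; ordS i is i + 1 modulo r.              *)
Definition arithmetic_rope (G : sgraph) (r : nat)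
    (q : 'I_r -> G) (Q : 'I_r -> bool -> seq G) : Prop :=
  [/\ forall (i : 'I_r) (b : bool),
        is_path (q i) (Q i b) (q (ordS i)) /\ odd (size (Q i b)) = b,
      forall h : 'I_r -> bool,
        is_induced_cycle (union_graph (fun i => path_graph (q i) (Q i (h i)))) &
      forall i j : 'I_r, i != j -> dist_at_least 5 (q i) (q j)].

Definition rope_within (G : sgraph) (X : {set G}) (r : nat)
    (q : 'I_r -> G) (Q : 'I_r -> bool -> seq G) : Prop :=
  forall i : 'I_r, q i \in X /\ forall b, {subset Q i b <= X}.

(* Main.v *)
(** Distance levels from a root [z] in a component of [G[X]] give a layer with
    a component [C0] of large chromatic number.  A chain of [r] segments, each
    realised by induced paths of both parities, is grown inside [C0] from a
    parent [u0] of one of its vertices, and is finally closed through the upper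
    levels.  What must be kept alive is a set [W] of large chromatic number,
    inside the connected set [C] where the chain continues, whose vertices have
    ancestors not touching the chain.  Balls of radius 4 are bipartite by the odd
    girth, so everything local can be discarded at cost 2.

    For one more segment, take distance levels from the end [v] of the chain, now
    in [C] together with the parents of [W]; this halves [W] but provides a
    connected set [D] inside a single level.  A shortest path from [v] to [D]
    avoids the parents of [W] except near its end, but may touch many
    grandparents.  If it touches the grandparents of few vertices, these are
    discarded, and an edge [x x'] of [D] with the two shortest paths to its ends
    gives routes to [x] of opposite parity.  Otherwise cut the path as soon as the
    set of spoiled vertices is not 2-colourable: it then contains an edge [x x']
    whose ends are reached through their own grandparents by routes of equal
    parity.  In both cases, remove from [D] the neighbourhood of the edge and of
    the last vertices of the routes; a large component of the rest is attached
    to the removed part at a vertex [t], and the absence of triangles and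
    pentagons yields induced paths of both parities from [v] to [t]. *)

Require Import Defs.
From mathcomp Require Import all_boot all_order all_algebra.
From mathcomp Require Import zify lra.

Set Implicit Arguments.
Unset Strict Implicit.
Unset Printing Implicit Defensive.

Section Graph.
Variable G : sgraph.
Local Notation e := (@sedge G).
Implicit Types (A B C D : {set G}) (x y z u v w : G) (p q : seq G).

Lemma edgeC x y : e x y = e y x.
Proof. exact: sedge_sym. Qed.

Lemma edge_neq x y : e x y -> x != y.
Proof. by apply: contraTneq => ->; rewrite sedge_irrefl. Qed.

(** * Colourings of vertex sets *)

(** Colourability of the induced subgraph is stated on the vertices of [G] itself, so that sets can
    be split and joined without changing the vertex type. *)
Definition col A k : bool :=
  [exists f : {ffun G -> 'I_k}, [forall x in A, forall y in A, e x y ==> (f x != f y)]].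

Lemma colP A k : reflect (exists f : G -> 'I_k,
  forall x y, x \in A -> y \in A -> e x y -> f x != f y) (col A k).
Proof.
apply: (iffP existsP) => [[f /'forall_in_'forall_in_implyP fP]|[f fP]].
  by exists f => x y Ax Ay; apply: fP.
exists [ffun x => f x]; apply/'forall_in_'forall_in_implyP => x Ax y Ay exy.
by rewrite !ffunE fP.
Qed.

Lemma col_nat A k (f : G -> nat) : (forall x, f x < k) ->
  (forall x y, x \in A -> y \in A -> e x y -> f x <> f y) -> col A k.
Proof.
move=> fk fA; apply/colP; exists (fun x => Ordinal (fk x)) => x y Ax Ay exy.
by apply/eqP => /(congr1 val) /=; apply: fA.
Qed.

Lemma col_sub A B k : A \subset B -> col B k -> col A k.
Proof.
move=> /subsetP sAB /colP [f fP]; apply/colP.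
by exists f => x y /sAB Bx /sAB By; apply: fP.
Qed.

Lemma col_leq A j k : j <= k -> col A j -> col A k.
Proof.
move=> jk /colP [f fP]; apply: (@col_nat _ _ f) => [x|x y Ax Ay exy /val_inj fxy].
  exact: leq_trans jk.
by have := fP x y Ax Ay exy; rewrite fxy eqxx.
Qed.

Lemma col_setU A B j k : col A j -> col B k -> col (A :|: B) (j + k).
Proof.
move=> /colP [f fP] /colP [g gP].
apply: (@col_nat _ _ (fun x => if x \in A then f x : nat else j + g x)) => [x|x y].
  by case: ifP => _; [rewrite ltn_addr | rewrite ltn_add2l].
rewrite !inE; case: ifP => Ax; case: ifP => Ay /= Bx By exy.
- by move/val_inj => E; move: (fP x y Ax Ay exy); rewrite E eqxx.
- by have := ltn_ord (f x); lia.
- by have := ltn_ord (f y); lia.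
- move=> /addnI /val_inj E; move: (gP x y Bx By exy); by rewrite E eqxx.
Qed.

Lemma ncol_setD A B j k : ~~ col A (j + k) -> col B k -> ~~ col (A :\: B) j.
Proof.
move=> nA cB; apply: contra nA => cD.
apply: (col_sub _ (col_setU cD cB)); apply/subsetP => x Ax.
by rewrite !inE Ax; case: (x \in B).
Qed.

Lemma ncol_neq0 A k : 0 < k -> ~~ col A k -> exists x, x \in A.
Proof.
move=> k0 nA; case: (set_0Vmem A) => [A0|[x Ax]]; last by exists x.
case/negP: nA; rewrite A0; apply: (@col_nat _ _ (fun=> 0)) => // x y.
by rewrite inE.
Qed.

Lemma ncol_edge A : ~~ col A 1 -> exists x y, [/\ x \in A, y \in A & e x y].
Proof.
move=> nA; have [/exists_inP[x Ax /exists_inP[y Ay exy]]|/exists_inPn noe] :=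
  boolP [exists x in A, [exists y in A, e x y]]; first by exists x, y.
case/negP: nA; apply: (@col_nat _ _ (fun=> 0)) => // x y Ax Ay exy.
by have /exists_inPn/(_ y Ay) := noe x Ax; rewrite exy.
Qed.

Lemma ncol_class A (c : G -> bool) : ~~ col A 2 ->
  exists b, ~~ col [set x in A | c x == b] 1.
Proof.
move=> nA; case: (boolP (col [set x in A | c x == true] 1)) => [c1|]; last by exists true.
exists false; apply: contra nA => c0.
apply: (col_sub _ (col_setU c1 c0)); apply/subsetP => x Ax.
by rewrite !inE Ax; case: (c x).
Qed.

(** Edges join equal or consecutive levels. If every level were [k]-colourable, two disjoint
    palettes alternating with the parity of the level would colour [A]. *)
Lemma ncol_level A (lev : G -> nat) k :
  (forall x y, x \in A -> y \in A -> e x y -> lev x <= (lev y).+1) ->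
  ~~ col A (k + k) -> exists j, ~~ col [set x in A | lev x == j] k.
Proof.
move=> levA nA; pose N := (\max_x lev x).+1.
have [/existsP[j nj]|/existsPn cj] :=
  boolP [exists j : 'I_N, ~~ col [set x in A | lev x == j] k].
  by exists (nat_of_ord j).
case/negP: nA.
have fP (j : 'I_N) : exists f : G -> 'I_k, forall x y, x \in A -> y \in A ->
    lev x = j -> lev y = j -> e x y -> f x != f y.
  have /colP[f fP] : col [set x in A | lev x == j] k by move: (cj j); rewrite negbK.
  exists f => x y Ax Ay lx ly; apply: fP; rewrite !inE ?Ax ?Ay ?lx ?ly /= eqxx //.
have [f fE] := fin_all_exists fP.
have levN x : lev x < N by rewrite ltnS (leq_bigmax x).
pose g x : nat := f (Ordinal (levN x)) x.
have gk x : g x < k by apply: ltn_ord.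
apply: (@col_nat _ _ (fun x => if odd (lev x) then g x else k + g x)) => [x|x y Ax Ay exy].
  by have := gk x; case: ifP; lia.
have := levA x y Ax Ay exy; have := levA y x Ay Ax; rewrite edgeC => /(_ exy).
move=> l1 l2; have gx := gk x; have gy := gk y.
have [El|ne] := eqVneq (lev x) (lev y); last first.
  have -> : odd (lev x) = ~~ odd (lev y) by lia.
  by case: (odd (lev y)) => /=; lia.
have gxy : g x <> g y.
  rewrite /g; have -> : Ordinal (levN x) = Ordinal (levN y) by apply: val_inj.
  by move/val_inj => E; move: (fE (Ordinal (levN y)) x y Ax Ay El erefl exy); rewrite E eqxx.
by rewrite El; case: (odd _) => //; lia.
Qed.

(** * Closed walks and balls *)

(** Induction on the length: a closed walk that repeats a vertex splits there into two shorter
    closed walks, one of them odd. Without repetition it is a cycle, since there are no loops. *)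
Lemma odd_closed_walk k c : odd_girth_at_least G k -> cycle e c -> odd (size c) -> k <= size c.
Proof.
move=> girth; have [n] := ubnP (size c); elim: n c => // n IH c cn ce co.
have [uc|] := boolP (uniq c).
  apply: girth => //; rewrite /is_cycle /ucycleb ce uc !andbT.
  case: c ce co {uc cn} => [|x [|y [|z c]]] //=.
  by rewrite sedge_irrefl.
case: c ce co cn => // x0 c' ce co cn nu.
set c := x0 :: c' in ce co cn nu *.
have [i [j [ij js nij]]] : exists i j, [/\ i < j, j < size c & nth x0 c i = nth x0 c j].
  move: nu => /(uniqPn x0) [i [j [ij js E]]]; by exists i, j.
set x := nth x0 c i.
(* Rotated to begin at the repeated vertex [x], the walk falls into the closed walks [x :: s1] and
   [x :: s2] named below. *)
have Ed : rot i c = x :: take (j - i).-1 (behead (rot i c)) ++ x :: behead (drop (j - i) (rot i c)).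
  have si : i < size c by lia.
  have sr : size (rot i c) = size c by rewrite size_rot.
  have hx : nth x0 (rot i c) 0 = x by rewrite /rot nth_cat size_drop nth_drop addn0; case: ifP => //; lia.
  have hy : nth x0 (rot i c) (j - i) = x.
    rewrite /rot nth_cat size_drop nth_drop subnKC; last lia.
    by rewrite -nij; case: ifP => //; lia.
  have hd : drop (j - i) (rot i c) = x :: behead (drop (j - i) (rot i c)).
    by rewrite {1}(drop_nth x0) ?sr ?hy -?drop1 ?drop_drop ?add1n //; lia.
  rewrite -{1}(cat_take_drop (j - i) (rot i c)) {1}hd -cat_cons; congr (_ ++ _).
  move: hx sr; case: (rot i c) => [|a t] /=; first lia.
  by move=> -> _; case: (j - i) (subn_gt0 i j) => [|d] //; rewrite ij.
have cr : cycle e (rot i c) by rewrite rot_cycle.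
have sr : size (rot i c) = size c by rewrite size_rot.
move: cr sr; rewrite Ed /=; set s1 := take _ _; set s2 := behead _.
rewrite size_cat /= rcons_cat cat_path /= => /and3P[p1 e1 p2] sr.
have szc : size c = (size c').+1 by [].
have c1 : cycle e (x :: s1) by rewrite /= rcons_path p1.
have c2 : cycle e (x :: s2) by [].
have : odd (size (x :: s1)) || odd (size (x :: s2)).
  by move: co; rewrite szc -sr /= addnS /= oddD; case: (odd (size s1)); case: (odd (size s2)).
have [l1 l2] : size (x :: s1) <= size c /\ size (x :: s2) <= size c.
  by rewrite szc -sr /= addnS; split; rewrite ltnS leqW ?leq_addr ?leq_addl.
have [n1 n2] : size (x :: s1) < n /\ size (x :: s2) < n.
  by move: cn; rewrite szc -sr /= addnS ltnS => cn;
    split; apply: leq_trans _ cn; rewrite !ltnS ?leq_addr ?leq_addl.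
by case/orP => o; [apply: leq_trans (IH _ n1 c1 o) l1 | apply: leq_trans (IH _ n2 c2 o) l2].
Qed.

(** Repetitions are allowed: walks of exact length concatenate and reverse freely, and their lengths
    add up. *)
Fixpoint walk n x y : bool :=
  if n is n'.+1 then [exists z, walk n' x z && e z y] else x == y.

Lemma walkS n x y z : walk n x y -> e y z -> walk n.+1 x z.
Proof. by move=> w eyz /=; apply/existsP; exists y; rewrite w eyz. Qed.

Lemma walk_path n x y : walk n x y ->
  exists p, [/\ path e x p, last x p = y & size p = n].
Proof.
elim: n y => [|n IH] y; first by move/eqP => <-; exists [::].
case/existsP => z /andP[/IH [p [pp lp sp]] ezy].
by exists (rcons p y); rewrite rcons_path pp lp ezy last_rcons size_rcons sp.
Qed.

Lemma path_walk p x : path e x p -> walk (size p) x (last x p).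
Proof.
elim/last_ind: p => [|p y IH]; first by rewrite /= eqxx.
rewrite rcons_path last_rcons size_rcons.
by case/andP => /IH; apply: walkS.
Qed.

Lemma walk_cat m n x y z : walk m x y -> walk n y z -> walk (m + n) x z.
Proof.
move=> /walk_path[p [pp lp sp]] /walk_path[q [pq lq sq]].
have := @path_walk (p ++ q) x; rewrite cat_path pp lp pq last_cat lp lq size_cat sp sq.
exact.
Qed.

Lemma walk_sym n x y : walk n x y -> walk n y x.
Proof.
elim: n y => [|n IH] y; first by rewrite /= eq_sym.
case/existsP => z /andP[/IH w ezy]; rewrite -add1n; apply: walk_cat w.
by apply/existsP; exists y; rewrite /= eqxx edgeC.
Qed.

Lemma edge_walk x y : e x y -> walk 1 x y.
Proof. by move=> exy /=; apply/existsP; exists x; rewrite eqxx exy. Qed.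

Lemma odd_closed k n x : odd_girth_at_least G k -> odd n -> walk n x x -> k <= n.
Proof.
move=> girth on /walk_path[p [pp lp sp]]; rewrite -sp; apply: odd_closed_walk => //.
  by rewrite (cycle_path x) lp.
by rewrite sp.
Qed.

(** The radius is 4, so that a vertex outside is at distance at least 5, as a rope requires. *)
Definition ball x : {set G} := [set y | [exists n : 'I_5, walk n x y]].

Lemma ballP x y : reflect (exists2 n, n <= 4 & walk n x y) (y \in ball x).
Proof.
rewrite inE; apply: (iffP existsP) => [[n w]|[n n4 w]]; first by exists n; rewrite // -ltnS.
by have n5 : n < 5 by []; exists (Ordinal n5).
Qed.

Lemma dist_ball x y : y \notin ball x -> dist_at_least 5 x y.
Proof.
move=> yb p /and3P[pp /eqP lp _]; rewrite ltnNge; apply: contra yb => s4.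
by apply/ballP; exists (size p); rewrite // -lp path_walk.
Qed.

Hypothesis girth : odd_girth_at_least G 11.

(** Colour by the existence of an even walk from [x] of length at most 4. A monochromatic edge would
    close an odd walk of length at most [4 + 1 + 4], below the odd girth. *)
Lemma col_ball x : col (ball x) 2.
Proof.
pose f y : nat := [|| walk 0 x y, walk 2 x y | walk 4 x y].
apply: (@col_nat _ _ f) => [y|y z /ballP[a a4 wa] /ballP[b b4 wb] eyz]; first exact: leq_b1.
have bad m n : m <= 4 -> n <= 4 -> walk m x y -> walk n x z -> odd (m + n) = false -> False.
  move=> m4 n4 wm wn mn.
  have /(odd_closed girth) : walk (m + (1 + n)) x x.
    exact: walk_cat wm (walk_cat (edge_walk eyz) (walk_sym wn)).
  lia.
rewrite /f; case: (boolP [|| walk 0 x y, _ | _]) => [y0|/norP[y0 /norP[y2 y4]]].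
  case: (boolP [|| walk 0 x z, _ | _]) => // z0 _.
  by case/or3P: y0 => wy; case/or3P: z0 => wz; apply: (bad _ _ _ _ wy wz).
case: (boolP [|| walk 0 x z, _ | _]) => // /norP[z0 /norP[z2 z4]] _.
have oa : odd a by case: a a4 wa => [|[|[|[|[|a]]]]] // _ wa; rewrite wa in y0 y2 y4.
have ob : odd b by case: b b4 wb => [|[|[|[|[|b]]]]] // _ wb; rewrite wb in z0 z2 z4.
by apply: (bad a b) => //; rewrite oddD oa ob.
Qed.

Lemma no_triangle x y z : e x y -> e y z -> ~~ e x z.
Proof.
move=> exy eyz; apply/negP; rewrite edgeC => ezx.
have := @odd_closed_walk _ [:: x; y; z] girth; rewrite /= exy eyz ezx.
by move=> /(_ isT isT).
Qed.

Lemma no_pentagon a b c d f : e a b -> e b c -> e c d -> e d f -> ~~ e a f.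
Proof.
move=> ab bc cd df; apply/negP; rewrite edgeC => fa.
have := @odd_closed_walk _ [:: a; b; c; d; f] girth; rewrite /= ab bc cd df fa.
by move=> /(_ isT isT).
Qed.

(** * Connected sets and distance levels *)

Definition rin A : rel G := [rel x y | [&& x \in A, y \in A & e x y]].

Definition conn A := forall x y, x \in A -> y \in A -> connect (rin A) x y.

Lemma rin_sym A : connect_sym (rin A).
Proof.
by apply: sym_connect_sym => x y; rewrite /rin /= edgeC andbCA.
Qed.

Lemma rin_edge A x y : x \in A -> y \in A -> e x y -> connect (rin A) x y.
Proof. by move=> Ax Ay exy; apply: connect1; rewrite /rin /= Ax Ay. Qed.

Lemma connect_rin_ind (P : G -> Prop) A x : P x ->
  (forall u w, P u -> u \in A -> w \in A -> e u w -> P w) ->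
  forall y, connect (rin A) x y -> P y.
Proof.
move=> Px step y /connectP[p pp ->]; elim: p x Px pp => //= u p IH x Px.
by case/andP => /and3P[Ax Au exu]; apply: IH; apply: step exu.
Qed.

Lemma rinS A B x y : A \subset B -> connect (rin A) x y -> connect (rin B) x y.
Proof.
move=> /subsetP sAB; move: y; apply: (@connect_rin_ind (connect (rin B) x)) => // u w xu Au Aw euw.
by apply: connect_trans xu _; apply: rin_edge; rewrite ?sAB.
Qed.

Lemma conn_root A x : (forall y, y \in A -> connect (rin A) x y) -> conn A.
Proof.
move=> h y z /h xy /h xz; apply: connect_trans xz; by rewrite rin_sym.
Qed.

Lemma conn_setU A B a : a \in A -> conn A ->
  (forall y, y \in B -> exists2 x, x \in A & connect (rin (A :|: B)) x y) -> conn (A :|: B).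
Proof.
move=> Aa cA AB; apply: (@conn_root _ a) => y; rewrite inE => /orP[Ay|/AB[x Ax]].
  exact: rinS (subsetUl A B) (cA a y Aa Ay).
by apply: connect_trans; apply: rinS (subsetUl A B) (cA a x Aa Ax).
Qed.

(** Colourings found separately on the components combine. The components are those of the subgraph
    induced by [A], while only the vertices of [B] are coloured. *)
Lemma ncol_comp A B k : 0 < k -> B \subset A -> ~~ col B k ->
  exists D, [/\ D \subset A, conn D,
    forall y z, y \in D -> z \in A -> e y z -> z \in D & ~~ col (B :&: D) k].
Proof.
move=> k0 sBA nB; pose K x := [set y in A | connect (rin A) x y].
have [/existsP[x nx]|/existsPn cx] := boolP [exists x, ~~ col (B :&: K x) k].
  exists (K x); split => //.
  - by apply/subsetP => y; rewrite inE => /andP[].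
  - have [y0] := ncol_neq0 k0 nx; rewrite !inE => /and3P[_ Ay0 xy0].
    have Kx y : connect (rin A) y0 y -> connect (rin (K x)) y0 y.
      move=> c0; suff [] : connect (rin (K x)) y0 y /\ connect (rin A) x y by [].
      move: y c0; apply: (@connect_rin_ind (fun y => connect (rin (K x)) y0 y /\ connect (rin A) x y)) => // u w [c1 c2] Au Aw euw.
      have c3 : connect (rin A) x w by apply: connect_trans c2 _; apply: rin_edge.
      split=> //; apply: connect_trans c1 _; apply: rin_edge; rewrite ?inE ?Au ?Aw //.
    apply: (@conn_root _ y0) => y; rewrite inE => /andP[_ xy]; apply: Kx.
    by apply: connect_trans xy; rewrite rin_sym.
  - move=> y z; rewrite !inE => /andP[Ay xy] Az eyz; rewrite Az.
    by apply: connect_trans xy _; apply: rin_edge.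
case/negP: nB.
have fP x : exists f : G -> 'I_k, forall y z, y \in B -> z \in B ->
    connect (rin A) x y -> connect (rin A) x z -> e y z -> f y != f z.
  have /colP[f fP] : col (B :&: K x) k by move: (cx x); rewrite negbK.
  exists f => y z By Bz xy xz; apply: fP; rewrite !inE ?By ?Bz ?(subsetP sBA) //.
have [f fE] := fin_all_exists fP.
(* Each vertex takes its colour from the colouring attached to the representative of its
   component. *)
apply/colP; exists (fun x => f (fingraph.root (rin A) x) x) => x y Bx By exy.
have cxy : connect (rin A) x y by apply: rin_edge; rewrite ?(subsetP sBA).
have <- : fingraph.root (rin A) x = fingraph.root (rin A) y by apply/fingraph.rootP => //; apply: rin_sym.
apply: fE => //; rewrite rin_sym; first exact: connect_root.
by apply: connect_trans (connect_root _ x); rewrite rin_sym.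
Qed.

(** Without such an edge, [A] would be closed under all neighbours in [D]; connectedness would bring
    [x] into [A], which is disjoint from [E]. *)
Lemma conn_attach D (E : {set G}) A x c : conn D -> x \in D -> x \in E -> c \in A -> A \subset D ->
  (forall y z, y \in A -> z \in D -> z \notin E -> e y z -> z \in A) -> [disjoint A & E] ->
  exists t y, [/\ t \in D, t \in E, y \in A & e t y].
Proof.
move=> cD Dx Ex Ac /subsetP AD clA dAE.
have [/existsP[t /existsP[y /and4P[]]]|none] :=
  boolP [exists t, [exists y, [&& t \in D, t \in E, y \in A & e t y]]]; first by exists t, y.
have Ax : x \in A.
  move: (cD c x (AD c Ac) Dx); apply: (@connect_rin_ind (fun y => y \in A)) => // u w Au Du Dw euw.
  apply: (clA u) => //; apply: contra none => Ew.
  by apply/existsP; exists w; apply/existsP; exists u; rewrite Dw Ew Au edgeC.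
by have := disjointFr dAE Ax; rewrite Ex.
Qed.

(** For [v] in [A], these clauses force [lev] to be the distance from [v] in the subgraph induced by
    [A], with [par] the parent map of a breadth-first tree. Nothing is said outside [A], nor about
    [par v]. *)
Definition levels A v (lev : G -> nat) (par : G -> G) :=
  [/\ lev v = 0,
      forall x, x \in A -> x != v -> [/\ par x \in A, e (par x) x & lev x = (lev (par x)).+1] &
      forall x y, x \in A -> y \in A -> e x y -> lev y <= (lev x).+1].

Lemma exists_levels A v : v \in A -> conn A -> exists lev par, levels A v lev par.
Proof.
move=> Av cA.
(* [bn n] holds at the ends of walks with [n] edges from [v] whose earlier vertices lie in [A]; the
   level is the least such [n]. *)
pose bn n : pred G := iter n (fun (b : pred G) y => [exists z in A, b z && e z y]) (pred1 v).
have bnS n x y : y \in A -> bn n y -> e y x -> bn n.+1 x.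
  by move=> Ay b eyx /=; apply/exists_inP; exists y; rewrite ?b.
have ex x : exists n, x \in A -> bn n x /\ forall m, bn m x -> n <= m.
  have [Ax|nAx] := boolP (x \in A); last by exists 0.
  have exn : exists n, bn n x.
    move: (cA v x Av Ax); apply: (@connect_rin_ind (fun x => exists n, bn n x)) => [|u w [n nu] Au Aw euw]; first by exists 0; apply: eqxx.
    by exists n.+1; apply: bnS euw.
  by case: (ex_minnP exn) => n bnx nmin; exists n.
have [lev levP] := fin_all_exists ex.
have ep x : exists y, x \in A -> x != v -> [/\ y \in A, e y x & lev x = (lev y).+1].
  have [Ax|nAx] := boolP (x \in A); last by exists v.
  have [->|xv] := eqVneq x v; first by exists v.
  have [bx bmin] := levP x Ax; case E: (lev x) bx => [|n].
    by move=> /= xv'; rewrite xv' in xv.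
  case/exists_inP => y Ay /andP[by_ eyx]; exists y => _ _; split=> //; congr _.+1.
  have [by1 ymin] := levP y Ay; apply/eqP; rewrite eqn_leq ymin // andbT.
  by rewrite -ltnS -E; apply: bmin; apply: bnS eyx.
have [par parP] := fin_all_exists ep; exists lev, par; split => //.
  have [_ vmin] := levP v Av; by apply/eqP; rewrite -leqn0; apply: vmin; apply: eqxx.
move=> x y Ax Ay exy; have [bx _] := levP x Ax; have [_ ymin] := levP y Ay.
by apply: ymin; apply: bnS exy.
Qed.

(** * Induced paths *)

Definition na x y := (x != y) && ~~ e x y.

Lemma naC x y : na x y = na y x.
Proof. by rewrite /na eq_sym edgeC. Qed.

(** An induced path, listed without its first vertex. As [na] includes being distinct, repeated
    vertices are excluded too. *)
Fixpoint ipath x p : bool :=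
  if p is y :: p' then [&& e x y, all (na x) p' & ipath y p'] else true.

(** The junction [last x p] is exempt from the last condition, because the second already governs
    its relation to [q]. *)
Lemma ipath_cat x p q : ipath x (p ++ q) =
  [&& ipath x p, ipath (last x p) q & all (fun u => all (na u) q) (belast x p)].
Proof.
elim: p x => [|y p IH] x /=; first by rewrite andbT.
rewrite IH all_cat; case: (e x y) => //=; case: (all (na x) p) => //=.
by case: (ipath y p) => /=; rewrite ?andbF //; case: (all (na x) q) => //=; rewrite ?andbF ?andbT.
Qed.

Lemma ipath_path x p : ipath x p -> path e x p.
Proof. by elim: p x => //= y p IH x /and3P[-> _ /IH]. Qed.

Lemma ipath_uniq x p : ipath x p -> uniq (x :: p).
Proof.
elim: p x => //= y p IH x /and3P[exy /allP nx /IH ->]; rewrite andbT inE negb_or edge_neq //=.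
by apply/negP => /nx; rewrite /na eqxx.
Qed.

(* Omits the root, like the paths of [is_path]. *)
Fixpoint route (par : G -> G) n x :=
  if n is n'.+1 then rcons (route par n' (par x)) x else [::].

Lemma size_route par n x : size (route par n x) = n.
Proof. by elim: n x => //= n IH x; rewrite size_rcons IH. Qed.

Section Levels.
Variables (A : {set G}) (v : G) (lev : G -> nat) (par : G -> G).
Hypothesis levA : levels A v lev par.

Lemma lev_pos x : x \in A -> 0 < lev x -> [/\ par x \in A, e (par x) x & lev x = (lev (par x)).+1].
Proof.
by case: levA => lv h _ Ax x0; apply: h => //; apply: contraTneq x0 => ->; rewrite lv.
Qed.

Lemma lev0 x : x \in A -> lev x = 0 -> x = v.
Proof.
case: levA => _ h _ Ax x0; apply/eqP; apply: contraT => xv.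
by have [_ _] := h x Ax xv; rewrite x0.
Qed.

Lemma lev_edge x y : x \in A -> y \in A -> e x y -> lev y <= (lev x).+1 /\ lev x <= (lev y).+1.
Proof. by case: levA => _ _ h Ax Ay exy; split; apply: h; rewrite // edgeC. Qed.

Lemma lev_na x y : x \in A -> y \in A -> (lev x).+1 < lev y \/ (lev y).+1 < lev x -> na x y.
Proof.
move=> Ax Ay h; rewrite /na; apply/andP; split.
  by apply: contraPneq h => ->; lia.
by apply: contraPN h => /(lev_edge Ax Ay); lia.
Qed.

Lemma lev_iter i x : x \in A -> i <= lev x -> iter i par x \in A /\ lev (iter i par x) = lev x - i.
Proof.
move=> Ax; elim: i => [|i IH] ix; first by rewrite subn0.
have [Ai li] := IH (ltnW ix).
have [||a _ b] := @lev_pos (iter i par x); rewrite //= ?li; first lia.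
split=> //; lia.
Qed.

Lemma last_route n x : x \in A -> lev x = n -> last v (route par n x) = x.
Proof. by case: n => [|n] Ax lx /=; rewrite ?last_rcons // (lev0 Ax). Qed.

Lemma mem_route n x u : x \in A -> lev x = n -> u \in route par n x ->
  u \in A /\ 0 < lev u <= n.
Proof.
elim: n x => // n IH x Ax lx; rewrite /= mem_rcons inE => /orP[/eqP ->|].
  by rewrite lx leqnn.
have [|Ap _] := lev_pos Ax; first by rewrite lx.
rewrite lx => -[lp] /(IH _ Ap (esym lp)) [Au /andP[-> un]]; split => //; exact: leqW.
Qed.

(** Levels increase by one along a route, so vertices that are not consecutive differ by at least
    two levels and cannot be adjacent. *)
Lemma ipath_route n x : x \in A -> lev x = n -> ipath v (route par n x).
Proof.
elim: n x => // n IH x Ax lx; have [|Ap ex] := lev_pos Ax; first by rewrite lx.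
rewrite lx => -[lp]; have lp' := esym lp; rewrite /= -cats1 ipath_cat IH // last_route //= ex /=.
apply/allP => u; rewrite andbT; case: n lx IH lp lp' => // n lx IH lp lp'.
rewrite /= belast_rcons inE.
have [|App _] := lev_pos Ap; first by rewrite lp'.
rewrite lp' => -[lpp].
(* The root lies in [A], because following parents from [x] ends at the only vertex of level 0. *)
have vA : v \in A.
  have [] := @lev_iter (lev x) x Ax (leqnn _); rewrite subnn => Ai /(lev0 Ai) E.
  by rewrite -E.
have lv : lev v = 0 by case: levA.
case/orP => [/eqP ->|ur]; apply: lev_na => //; try (left; lia).
  by case: (mem_route App _ ur).
by case: (mem_route App (esym lpp) ur) => _; lia.
Qed.

(** The vertices of a route have levels 1 to [n] in order, so the first one satisfying [P] has level
    one more than its index. Cutting there leaves a route that meets [P] only at its end. *)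
Lemma route_find (P : pred G) n x : x \in A -> lev x = n -> has P (route par n x) ->
  exists y, [/\ y \in A, P y, lev y = (find P (route par n x)).+1 /\ lev y <= n,
    ~~ has P (route par (lev y).-1 (par y)) & {subset route par (lev y) y <= route par n x}].
Proof.
elim: n x => // n IH x Ax lx; have [|Ap _] := lev_pos Ax; first by rewrite lx.
rewrite lx => -[lp] /=; rewrite -cats1 has_cat find_cat size_route /= orbF.
case: (boolP (has P (route par n (par x)))) => [hP _|nP].
  have [y [Ay Py [ly yn] nh sub]] := IH _ Ap (esym lp) hP; exists y; split => //.
    by split => //; apply: leqW.
  by move=> u /sub; rewrite mem_cat => ->.
move=> /= Px; exists x; rewrite lx Px addn0 cats1; split => //=.
Qed.

End Levels.

(** A shortest path from [v] in [A] with [v] added is induced and never returns to [v]. *)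
Lemma conn_ipath A v c t : conn A -> v \notin A -> c \in A -> e v c -> t \in A ->
  exists p, [/\ ipath v p, last v p = t & {subset p <= A}].
Proof.
move=> cA nv Ac evc At.
have cvA : conn (A :|: [set v]).
  apply: (conn_setU Ac) => // y /set1P ->; exists c => //.
  by apply: rin_edge; rewrite ?inE ?Ac ?eqxx ?orbT // edgeC.
have vA : v \in A :|: [set v] by rewrite !inE eqxx orbT.
have tA : t \in A :|: [set v] by rewrite inE At.
have [lev [par lP]] := exists_levels vA cvA.
exists (route par (lev t) t); rewrite (ipath_route lP) // (last_route lP) //; split=> // u ut.
have [] := mem_route lP tA erefl ut; rewrite !inE => /orP[//|/eqP ->].
by case: lP => ->.
Qed.

(** The end [t] is exempt from [S]: it starts the next segment and may touch what comes later. *)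
Definition opposite_paths v t (S : pred G) := exists Q : bool -> seq G, forall b,
  [/\ ipath v (Q b), last v (Q b) = t, odd (size (Q b)) = b & {subset belast v (Q b) <= S}].

Lemma opposite_pathsI v t (S : pred G) p q : ipath v p -> ipath v q -> last v p = t -> last v q = t ->
  odd (size p) = ~~ odd (size q) -> {subset belast v p <= S} -> {subset belast v q <= S} ->
  opposite_paths v t S.
Proof.
move=> ip iq lp lq opq sp sq.
exists (fun b => if odd (size p) == b then p else q) => b.
case: (eqVneq (odd (size p)) b) => [<-|ne]; split=> //.
by move: ne; rewrite opq; case: b; case: (odd (size q)).
Qed.

Lemma opposite_paths_sub v t (S S' : pred G) : {subset S <= S'} ->
  opposite_paths v t S -> opposite_paths v t S'.
Proof. by move=> sS [Q QP]; exists Q => b; have [? ? ? h] := QP b; split => // u /h /sS. Qed.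

Lemma belast_cat2 v b x y : belast v (b ++ [:: x; y]) = v :: b ++ [:: x].
Proof. by have -> : b ++ [:: x; y] = rcons (b ++ [:: x]) y; rewrite ?belast_rcons // -cats1 -catA. Qed.

(** * A diamond over an edge *)

Section Diamond.
Variables (D : {set G}) (v x x' t l l' m m' : G) (b b' : seq G).
Hypotheses (Dx : x \in D) (Dx' : x' \in D) (Dt : t \in D) (exx' : e x x').
Hypotheses (ib : ipath v (b ++ [:: m; l])) (ib' : ipath v (b' ++ [:: m'; l'])).
Hypotheses (lx : e l x) (lx' : e l' x').
Hypotheses (Dl : l \notin D) (Dl' : l' \notin D).
Hypotheses (bD : forall u d, u \in v :: b ++ [:: m] -> d \in D -> na u d).
Hypotheses (bD' : forall u d, u \in v :: b' ++ [:: m'] -> d \in D -> na u d).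
Hypotheses (bl : forall u, u \in v :: b -> na u l') (bl' : forall u, u \in v :: b' -> na u l).
Hypothesis parity : odd (size b) = odd (size b').
Hypotheses (tx : t != x) (tx' : t != x').

Let S := [pred u | u \in (v :: b ++ [:: m; l; x]) ++ (v :: b' ++ [:: m'; l'; x'])].

(** If [t] is adjacent to [x], the path ending in [l x t] is paired with one ending in [l' t] or
    [l' x' x t]. Otherwise [t] is adjacent to [l], and the path ending in [l t] is paired with one
    ending in [l' l t] or [l' x' x l t]. The parities differ in each pair; chords would close a
    triangle or a pentagon, or are excluded by hypothesis. *)
Lemma diamond_half : e x t || e l t && ~~ e x' t -> opposite_paths v t S.
Proof using All.
have Dne u d : u \notin D -> d \in D -> u != d by move=> nu Dd; apply: contraNneq nu => ->.
have nlx' : na l x' by rewrite /na Dne // (no_triangle lx exx').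
have ex'x : e x' x by rewrite edgeC.
have nl'x : na l' x by rewrite /na Dne // (no_triangle lx' ex'x).
move: (ib); rewrite ipath_cat /= => /and3P[ib1 /and3P[emb _ /andP[eml _]] ib2].
move: (ib'); rewrite ipath_cat /= => /and3P[ib1' /and3P[emb' _ /andP[eml' _]] ib2'].
have mD d : d \in D -> na m d by move=> Dd; apply: bD => //; rewrite inE mem_cat inE eqxx !orbT.
have mD' d : d \in D -> na m' d by move=> Dd; apply: bD' => //; rewrite inE mem_cat inE eqxx !orbT.
have ext s : ipath l s -> {subset s <= D} -> ipath v (b ++ [:: m, l & s]).
  move=> is_ sD; have -> : b ++ [:: m, l & s] = (b ++ [:: m; l]) ++ s by rewrite -catA.
  rewrite ipath_cat ib last_cat /= is_ /=; apply/allP => u ub; apply/allP => d /sD Dd; apply: bD => //.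
  by move: ub; rewrite belast_cat2.
have ext' s : ipath l' s -> all (na m') s -> all (fun u => all (na u) s) (v :: b') ->
    ipath v (b' ++ [:: m', l' & s]).
  move=> is_ ms bs; have -> : b' ++ [:: m', l' & s] = (b' ++ [:: m'; l']) ++ s by rewrite -catA.
  by rewrite ipath_cat ib' last_cat /= is_ belast_cat2 -cat_cons all_cat bs /= ms.
have nb'D s : {subset s <= D} -> all (fun u => all (na u) s) (v :: b').
  move=> sD; apply/allP => u ub; apply/allP => d /sD Dd; apply: bD' => //.
  by rewrite -cat_cons mem_cat ub.
have nm'D s : {subset s <= D} -> all (na m') s by move=> sD; apply/allP => d /sD; apply: mD'.
have subS q : {subset v :: q <= S} -> {subset belast v (rcons q t) <= S} by rewrite belast_rcons.
have [Sv Sm Sl Sx] : [/\ S v, S m, S l & S x].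
  by rewrite /S /= !(inE, mem_cat) !eqxx !orbT.
have [Sm' Sl' Sx'] : [/\ S m', S l' & S x'].
  by rewrite /S /= !(inE, mem_cat) !eqxx !orbT.
have Sb : all S b by apply/allP => u ub; rewrite /S /= !(inE, mem_cat) ub !orbT.
have Sb' : all S b' by apply/allP => u ub; rewrite /S /= !(inE, mem_cat) ub !orbT.
move: (S) subS Sv Sm Sl Sx Sm' Sl' Sx' Sb Sb' => S0 subS Sv Sm Sl Sx Sm' Sl' Sx' Sb Sb'.
(* [b] and [b'] have lengths of equal parity and the remaining fixed parts have equal length, so
   only the parities of [q] and [q'] matter. *)
have finish q q' : ipath v (b ++ [:: m, l & rcons q t]) -> ipath v (b' ++ [:: m', l' & rcons q' t]) ->
    odd (size q) = ~~ odd (size q') -> all S0 q -> all S0 q' -> opposite_paths v t S0.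
  move=> i1 i2 oq sq sq'; apply: (opposite_pathsI i1 i2); rewrite ?last_cat /= ?last_rcons //.
  - rewrite !size_cat /= !size_rcons !addnS /= !oddD parity oq.
    by case: (odd (size b')); case: (odd (size q')).
  - rewrite -rcons_cons -rcons_cons -rcons_cat; apply: subS.
    by apply/(@allP _ S0); rewrite /= all_cat /= Sv Sb Sm Sl sq.
  - rewrite -rcons_cons -rcons_cons -rcons_cat; apply: subS.
    by apply/(@allP _ S0); rewrite /= all_cat /= Sv Sb' Sm' Sl' sq'.
have subD s : all (fun u => u \in D) s -> {subset s <= D} by move/allP.
have nl't : ~~ e l' t -> na l' t by move=> h; rewrite /na Dne.
have [ext_ | next] /= := boolP (e x t).
  have nx't : na x' t by rewrite /na eq_sym tx' (no_triangle ex'x ext_).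
  have nlt : na l t by rewrite /na Dne // (no_triangle lx ext_).
  have i1 : ipath v (b ++ [:: m; l; x; t]).
    by apply: ext; [rewrite /= lx nlt ext_ | apply: subD; rewrite /= Dx Dt].
  move=> _; case: (boolP (e l' t)) => [l't|/nl't l't].
    apply: (finish [:: x] [::]) => //; last by rewrite /= Sx.
    have sD : {subset [:: t] <= D} by apply: subD; rewrite /= Dt.
    by apply: ext'; rewrite ?nm'D ?nb'D //= l't.
  apply: (finish [:: x] [:: x'; x]) => //; try by rewrite /= ?Sx ?Sx'.
  have sD : {subset [:: x'; x; t] <= D} by apply: subD; rewrite /= Dx Dx' Dt.
  by apply: ext'; rewrite ?nm'D ?nb'D //= lx' nl'x l't ex'x nx't ext_.
case/andP => elt nex't.
have nxt : na x t by rewrite /na eq_sym tx.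
have nx't : na x' t by rewrite /na eq_sym tx'.
have etl : e t l by rewrite edgeC.
have ex'l' : e x' l' by rewrite edgeC.
have exl : e x l by rewrite edgeC.
(* An edge between [l'] and [t] would close the pentagon [t l x x' l']. *)
have {}nl't : na l' t by apply: nl't; rewrite edgeC (no_pentagon etl lx exx' ex'l').
have i1 : ipath v (b ++ [:: m; l; t]).
  by apply: ext; [rewrite /= elt | apply: subD; rewrite /= Dt].
have m'l : m' != l.
  by apply: contraTneq lx => <-; have := mD' x Dx; rewrite /na => /andP[].
have nb't : all (fun u => all (na u) [:: t]) (v :: b') by apply: nb'D; apply: subD; rewrite /= Dt.
case: (boolP (e l l')) => [ll'|nll'].
  have l'l : e l' l by rewrite edgeC.
  apply: (finish [::] [:: l]) => //; last by rewrite /= Sl.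
  apply: ext'.
  - by rewrite /= l'l nl't elt.
  - by rewrite /= (mD' t Dt) andbT /na m'l (no_triangle eml' l'l).
  - by apply/allP => u ub; have := allP nb't u ub; rewrite /= bl'.
have nl'l : na l' l.
  rewrite /na edgeC nll' andbT; apply: contraTneq lx' => ->.
  by case/andP: nlx'.
have nm'l : na m' l by rewrite /na m'l (no_pentagon eml' lx' ex'x exl).
apply: (finish [::] [:: x'; x; l]) => //; last by rewrite /= Sl Sx Sx'.
apply: ext'.
- by rewrite /= lx' nl'x nl'l nl't ex'x (naC x' l) nlx' nx't exl nxt elt.
- by rewrite /= nm'l !mD'.
- apply/allP => u ub; have := allP nb't u ub.
  by rewrite /= bl' // !bD' // -cat_cons mem_cat ub.
Qed.

End Diamond.

(** The two routes play symmetric roles: when the half above does not apply directly, it applies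
    after exchanging them. *)
Lemma diamond D v x x' t l l' m m' b b' : x \in D -> x' \in D -> t \in D -> e x x' ->
  ipath v (b ++ [:: m; l]) -> ipath v (b' ++ [:: m'; l']) -> e l x -> e l' x' ->
  l \notin D -> l' \notin D ->
  (forall u d, u \in v :: b ++ [:: m] -> d \in D -> na u d) ->
  (forall u d, u \in v :: b' ++ [:: m'] -> d \in D -> na u d) ->
  (forall u, u \in v :: b -> na u l') -> (forall u, u \in v :: b' -> na u l) ->
  odd (size b) = odd (size b') -> t != x -> t != x' ->
  [|| e l t, e x t, e x' t | e l' t] ->
  opposite_paths v t [pred u | u \in (v :: b ++ [:: m; l; x]) ++ (v :: b' ++ [:: m'; l'; x'])].
Proof.
move=> Dx Dx' Dt exx' ib ib' lx lx' Dl Dl' bD bD' bl bl' par tx tx' att.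
have [h|] := boolP (e x t || e l t && ~~ e x' t).
  exact: (diamond_half Dx Dx' Dt exx' ib ib' lx lx' Dl Dl' bD bD' bl bl' par).
rewrite negb_or => /andP[nxt h].
have {}h : e x' t || e l' t && ~~ e x t.
  by move: att h; rewrite (negbTE nxt); case: (e l t); case: (e x' t); case: (e l' t).
have ex'x : e x' x by rewrite edgeC.
have sub s1 s2 : {subset [pred u | u \in s1 ++ s2] <= [pred u : G | u \in s2 ++ s1]}.
  by move=> u; rewrite !inE !mem_cat orbC.
apply: (opposite_paths_sub _ (diamond_half Dx' Dx Dt ex'x ib' ib lx' lx Dl' Dl bD' bD bl' bl (esym par) tx' tx h)).
by apply: sub.
Qed.

(** * Growing the chain *)

Section Rope.
Implicit Types W : {set G}.
Variables (K : {set G}) (z : G) (lev : G -> nat) (par : G -> G) (k : nat) (g0 : G).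
Hypotheses (levK : levels K z lev par) (k5 : 5 <= k) (Kg0 : g0 \in K) (lg0 : lev g0 + 2 = k).

Definition layer : {set G} := [set x in K | lev x == k].

(** For [W] in the layer these are the ancestors at levels [k - 1], [k - 2] and [k - 3]; the next
    ones already belong to [low]. *)
Definition tails W : {set G} := \bigcup_(i < 3) [set iter i.+1 par w | w in W].

(** The vertex [par g0], at level [k - 3], is the target of the closing path; [g0] will join it to
    the start of the chain. *)
Definition low : {set G} := [set x in K | lev x + 4 <= k] :|: [set par g0].

Definition region C W : {set G} := C :|: tails W :|: low.

(* [v] is the end of the chain built so far and [C] is where it continues; the
   chain is closed from a vertex of [W] through its ancestors. Earlier vertices
   of the chain do not occur: the step returns paths without any edge to the
   region left for the sequel. *)
Record state v C W : Prop := State {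
  st_layer : C \subset layer;
  st_conn : conn C;
  st_out : v \notin C;
  st_att : exists2 c, c \in C & e v c;
  st_sub : W \subset C;
  st_K : v \in K;
  st_lev : k <= (lev v).+1;
  st_tails : forall y, y \in tails W -> na v y;
  st_ball : forall w, w \in W -> w \notin ball g0 }.

Lemma tailsP W y : reflect (exists i w, [/\ i < 3, w \in W & y = iter i.+1 par w]) (y \in tails W).
Proof.
apply: (iffP bigcupP) => [[i _ /imsetP[w Ww ->]]|[i [w [i3 Ww ->]]]]; first by exists i, w.
by exists (Ordinal i3) => //; apply: imset_f.
Qed.

Lemma layerP x : x \in layer -> x \in K /\ lev x = k.
Proof. by rewrite inE => /andP[Kx /eqP]. Qed.

Lemma layer_iter i x : x \in layer -> i <= 4 -> iter i par x \in K /\ lev (iter i par x) = k - i.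
Proof. by move=> /layerP[Kx lx] i4; have := lev_iter levK (i := i) Kx; rewrite lx; apply; apply: leq_trans i4 (ltnW k5). Qed.

Lemma layer_edge i x : x \in layer -> i <= 4 -> e (iter i.+1 par x) (iter i par x).
Proof.
move=> Lx i4; have [Ki li] := layer_iter Lx i4.
by have [|] := lev_pos levK Ki; rewrite ?li //; move: k5 i4; clear; lia.
Qed.

Lemma walk_iter i x : x \in layer -> i <= 4 -> walk i x (iter i par x).
Proof.
move=> Lx; elim: i => [|i IH] i4; first exact: eqxx.
by apply: walkS (IH (ltnW i4)) _; rewrite edgeC layer_edge // ltnW.
Qed.

(** Since [w] is at distance at least 5 from [p], the vertex [u] and the ancestor of [w] are at
    distance at least [5 - (i + j)], which is at least 2. *)
Lemma ball_na (p : G) i u j w : w \notin ball p -> walk i p u -> w \in layer -> i + j <= 3 ->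
  na u (iter j par w).
Proof.
move=> nb wi Lw ij; have wj := walk_sym (walk_iter (i := j) Lw _).
rewrite /na; apply/andP; split; apply: contra nb.
  move/eqP=> E; apply/ballP; exists (i + j); first exact: leqW.
  by apply: walk_cat wi _; rewrite E; apply: wj; move: ij; clear; lia.
move=> euj; apply/ballP; exists (i + (1 + j)); first by rewrite addnCA.
by apply: walk_cat wi (walk_cat (edge_walk euj) (wj _)); move: ij; clear; lia.
Qed.

(** Apart from [par g0], the set [low] stays at levels up to [k - 4]. A vertex at level [k - 2]
    therefore only has to avoid [par g0] explicitly. *)
Lemma low_na u y : u \in K -> y \in low -> k <= (lev u).+1 \/ k <= (lev u).+2 /\ na u (par g0) ->
  na u y.
Proof.
move=> Ku; have [||Kh _ lh] := @lev_pos _ _ _ _ levK g0 => //; first lia.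
rewrite !inE => /orP[/andP[Ky ly]|/eqP ->] [lu|[lu ?]] //; apply: (lev_na levK) => //; lia.
Qed.

Lemma regionS C W C' W' : C' \subset C -> W' \subset W -> region C' W' \subset region C W.
Proof.
move=> sC sW; apply: setSU; apply: setUSS => //; apply/subsetP => y /tailsP[i [w [i3 Ww ->]]].
by apply/tailsP; exists i, w; split; rewrite ?(subsetP sW).
Qed.

(** * One step of the chain *)

Section Step.
Variables (v : G) (C W : {set G}).
Hypothesis st : state v C W.

(** With the parents of [W] included, the parent of a vertex at distance [j] from [v] is at distance
    at least [j - 1], so routes that stop at distance [j - 3] cannot touch it. *)
Let Ga : {set G} := C :|: par @: W :|: [set v].

Lemma W_layer w : w \in W -> w \in layer.
Proof. by move=> /(subsetP (st_sub st)) /(subsetP (st_layer st)). Qed.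

Lemma Ga_conn : conn Ga.
Proof.
have [c Cc evc] := st_att st.
rewrite /Ga -setUA; apply: (conn_setU Cc (st_conn st)) => y.
rewrite in_setU => /orP[/imsetP[w Ww ->]|/set1P ->].
  have Cw := subsetP (st_sub st) w Ww; exists w => //.
  apply: rin_edge; rewrite ?in_setU ?Cw ?imset_f ?orbT //.
  by rewrite edgeC (layer_edge (i := 0)) // W_layer.
by exists c => //; apply: rin_edge; rewrite ?in_setU ?Cc ?inE ?eqxx ?orbT // edgeC.
Qed.

Lemma Ga_v : v \in Ga. Proof. by rewrite !inE eqxx orbT. Qed.
Lemma Ga_C c : c \in C -> c \in Ga. Proof. by rewrite !inE => ->. Qed.
Lemma Ga_par w : w \in W -> par w \in Ga. Proof. by move=> Ww; rewrite !in_setU imset_f ?orbT. Qed.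

Lemma Ga_lev u : u \in Ga -> u \in K /\ k <= (lev u).+1.
Proof.
rewrite !in_setU => /orP[/orP[Cu|/imsetP[w Ww ->]]|/set1P ->].
- by have [Ku ->] := layerP (subsetP (st_layer st) u Cu).
- by have [Ku /= ->] := layer_iter (i := 1) (W_layer Ww) isT; split=> //; lia.
- by split; [apply: st_K st | apply: st_lev st].
Qed.

Variables (l2 : G -> nat) (p2 : G -> G).
Hypothesis levG : levels Ga v l2 p2.

Let gp w := par (par w).
Let R s := route p2 (l2 s) s.

Variables (j n : nat) (D W2 : {set G}).
Hypotheses (D_C : D \subset C) (D_j : forall d, d \in D -> l2 d = j)
  (D_conn : conn D) (D_ball : forall d, d \in D -> d \notin ball v)
  (W2_W : W2 \subset W) (W2_D : W2 \subset D) (nW2 : ~~ col W2 (n + 10)).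

(* Vertices that may not be used for closing a chain following [R s]. *)
Let Bo s : {set G} := [set w in W2 | has (e (gp w)) (R s)].

(** The conditions on [ball v] separate [v] from the new end and from all later ends, which lie in
    [C']. *)
Definition step_result := exists v' C' W' (Q : bool -> seq G),
  [/\ [/\ state v' C' W', C' \subset C, W' \subset W & v' \in C], ~~ col W' n,
    v' \notin ball v, (forall y, y \in C' -> y \notin ball v) &
    forall b, [/\ ipath v (Q b), last v (Q b) = v', odd (size (Q b)) = b,
      {subset Q b <= region C W} &
      forall u y, u \in belast v (Q b) -> y \in region C' W' -> na u y]].

(* [x] is joined to [v] by the route [R s], [m], [l]: here [m] and [l] are either
   the last two vertices of a shortest path before [x], or the grandparent and
   the parent of [x]. *)
Record link x s m l : Prop := Link {
  lk_s : s \in Ga;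
  lk_sj : l2 s + 3 <= j;
  lk_path : ipath v (R s ++ [:: m; l]);
  lk_lx : e l x;
  lk_lD : l \notin D;
  lk_m : m \in C :|: par @: W :|: [set gp w | w in W2];
  lk_mD : forall d, d \in D -> na m d;
  lk_l : l \in C :|: par @: W;
  lk_lj : j <= (l2 l).+1 }.

Lemma mem_R s u : s \in Ga -> u \in R s -> [/\ u \in Ga, u != v & l2 u <= l2 s].
Proof.
move=> Gs us; have [Gu /andP[u0 ul]] := mem_route levG Gs erefl us; split=> //.
by apply: contraTneq u0 => ->; case: levG => ->.
Qed.

Lemma vR_na s u y : s \in Ga -> l2 s + 3 <= j -> u \in v :: R s -> y \in Ga -> j <= (l2 y).+1 -> na u y.
Proof.
move=> Gs sj; rewrite inE => us Gy yj.
have [Gu lu] : u \in Ga /\ l2 u <= l2 s.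
  by case/orP: us => [/eqP ->|/(mem_R Gs)[]//]; rewrite Ga_v; case: levG => ->.
by apply: (lev_na levG) => //; left; move: lu sj yj; clear; lia.
Qed.

Lemma par_lev w : w \in W2 -> j <= (l2 (par w)).+1.
Proof.
move=> W2w; have Ww := subsetP W2_W w W2w; have Dw := subsetP W2_D w W2w.
have Cw := subsetP D_C w Dw.
have ew := layer_edge (i := 0) (W_layer Ww) isT.
by have [] := lev_edge levG (Ga_par Ww) (Ga_C Cw) ew; rewrite D_j.
Qed.

(** Parents are avoided by the distances from [v], grandparents because [w] is outside [Bo s], and
    great-grandparents by the levels from [z]. The vertex [v] itself is covered by the state. *)
Lemma vR_tails s u w i : s \in Ga -> l2 s + 3 <= j -> u \in v :: R s -> w \in W2 -> w \notin Bo s ->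
  i < 3 -> na u (iter i.+1 par w).
Proof.
move=> Gs sj us W2w nBo i3; have Ww := subsetP W2_W w W2w.
move: (us); rewrite inE => /orP[/eqP ->|uR].
  by apply: (st_tails st); apply/tailsP; exists i, w.
have [Gu _ _] := mem_R Gs uR; have [Ku lu] := Ga_lev Gu.
case: i i3 => [|i] i3; first by apply: vR_na us _ _; rewrite ?Ga_par ?par_lev.
have [Ki li] := layer_iter (i := i.+2) (W_layer Ww) (leqW i3).
case: i i3 Ki li => [|[|i]] i3 Ki li //; last first.
  by apply: (lev_na levK) => //; rewrite li; right; move: k5 lu; clear; lia.
rewrite /na; apply/andP; split; first by apply: contraTneq lu => ->; rewrite li; move: k5; clear; lia.
apply: contra nBo => ue; rewrite inE W2w /=; apply/hasP; exists u => //.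
by rewrite edgeC.
Qed.

(** Both cases of the step end here. Two of the [n + 2] colours pay for the ball around the new end
    [t], which keeps [t] away from the ancestors of [W']. *)
Lemma step_links x x' s s' m m' l l' W3 : link x s m l -> link x' s' m' l' ->
  x \in D -> x' \in D -> e x x' -> odd (l2 s) = odd (l2 s') ->
  W3 \subset W2 :\: (Bo s :|: Bo s' :|: (ball m :|: ball m')) -> ~~ col W3 (n + 2) ->
  step_result.
Proof.
move=> lk lk' Dx Dx' exx' par_s W3sub nW3.
have W3P w : w \in W3 -> [/\ w \in W2, w \notin Bo s, w \notin Bo s', w \notin ball m & w \notin ball m'].
  move/(subsetP W3sub); rewrite in_setD !in_setU !negb_or => /andP[/andP[/andP[? ?] /andP[? ?]] ?].
  by split.
have D_layer d : d \in D -> d \in layer by move/(subsetP D_C)/(subsetP (st_layer st)).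
have L_layer w : w \in W2 -> w \in layer by move/(subsetP W2_D)/D_layer.
have lkm x0 s0 m0 l0 : link x0 s0 m0 l0 -> walk 1 m0 l0 /\ walk 2 m0 x0.
  move=> k0; have w1 : walk 1 m0 l0.
    apply: edge_walk; move: (lk_path k0); rewrite ipath_cat /=.
    by case/and3P=> _ /and3P[_ _ /andP[]].
  by split=> //; apply: walkS w1 (lk_lx k0).
have [wl wx] := lkm _ _ _ _ lk; have [wl' wx'] := lkm _ _ _ _ lk'.
pose S := [:: l; x; x'; l'].
(* This is the closed neighbourhood of [S], since [na] also demands distinctness. *)
pose NS : {set G} := [set y | has (fun u => ~~ na u y) S].
have NSP y : y \notin NS -> forall u, u \in S -> na u y.
  by rewrite inE => /hasPn h u /h; rewrite negbK.
(* Every vertex of [S] is within distance 2 of [m] or [m'], whose balls of radius 4 miss [W3]. *)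
have W3NS : W3 \subset D :\: NS.
  apply/subsetP => w /W3P[W2w _ _ bm bm']; have Lw := L_layer w W2w.
  rewrite in_setD (subsetP W2_D) // andbT inE; apply/hasPn => u; rewrite negbK !inE.
  case/or4P=> /eqP ->; [apply: (ball_na (j := 0) bm wl) | apply: (ball_na (j := 0) bm wx) |
    apply: (ball_na (j := 0) bm' wx') | apply: (ball_na (j := 0) bm' wl')] => //.
have n2 : 0 < n + 2 by rewrite addn2.
have [C' [C'D C'conn C'cl nC']] := ncol_comp n2 W3NS nW3.
have [c] := ncol_neq0 n2 nC'.
rewrite inE => /andP[_ C'c].
have C'P y : y \in C' -> y \in D /\ y \notin NS.
  by move/(subsetP C'D); rewrite in_setD => /andP[].
have NSx : x \in NS by rewrite inE; apply/hasP; exists x; rewrite /na ?eqxx // !inE eqxx orbT.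
have [|||t [y [Dt NSt C'y ety]]] := @conn_attach D NS C' x c D_conn Dx NSx C'c.
- by apply/subsetP => y /C'P[].
- move=> y y' C'y Dy' nsy' eyy'; apply: C'cl C'y _ eyy'; by rewrite in_setD nsy'.
- by rewrite disjoint_subset; apply/subsetP => y /C'P[].
have [Dy nsy] := C'P y C'y.
have tS u : u \in S -> t != u.
  by move=> Su; have := NSP y nsy u Su; rewrite /na => /andP[_]; apply: contraNneq => <-.
(* The neighbour [y] of [t] is outside [NS], so [t] is not in [S]; being in [NS], it is adjacent to
   a member of [S]. *)
have att : [|| e l t, e x t, e x' t | e l' t].
  move: NSt; rewrite inE => /hasP[u Su]; rewrite /na negb_and negbK eq_sym (negbTE (tS u Su)) negbK /=.
  by move: Su; rewrite !inE => /or4P[] /eqP -> ->; rewrite ?orbT.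
pose W' := (W3 :&: C') :\: ball t.
have W'P w : w \in W' -> [/\ w \in W3, w \in C' & w \notin ball t].
  by rewrite in_setD in_setI => /and3P[? ? ?]; split.
have C'C : C' \subset C by apply: subset_trans D_C; apply/subsetP => w /C'P[].
have W'W : W' \subset W.
  by apply/subsetP => w /W'P[/W3P[W2w _ _ _ _] _ _]; apply: (subsetP W2_W).
have Ct : t \in C by apply: (subsetP D_C).
have [Kt lt_] := layerP (D_layer t Dt).
have st' : state t C' W'.
  split=> //.
  - by apply: subset_trans C'C (st_layer st).
  - by apply: contraTN NSt => /C'P[].
  - by exists y.
  - by apply/subsetP => w /W'P[].
  - by rewrite lt_.
  - move=> _ /tailsP[i [w [i3 /W'P[/W3P[W2w _ _ _ _] _ bt] ->]]].
    by apply: (ball_na (i := 0)) bt _ (L_layer w W2w) _ => //; apply: eqxx.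
  - by move=> w /(subsetP W'W) Ww; apply: (st_ball st).
have lkD x0 s0 m0 l0 : link x0 s0 m0 l0 -> forall u d, u \in v :: R s0 ++ [:: m0] -> d \in D -> na u d.
  move=> k0 u d; rewrite -cat_cons mem_cat mem_seq1 => /orP[us|/eqP ->] Dd; last exact: lk_mD k0 d Dd.
  apply: (vR_na (lk_s k0) (lk_sj k0) us); first by apply: Ga_C; apply: (subsetP D_C).
  by rewrite D_j.
have Ga_l x0 s0 m0 l0 : link x0 s0 m0 l0 -> l0 \in Ga.
  by move=> k0; rewrite /Ga in_setU (lk_l k0).
have lkl x0 s0 m0 l0 x1 s1 m1 l1 : link x0 s0 m0 l0 -> link x1 s1 m1 l1 ->
    forall u, u \in v :: R s0 -> na u l1.
  move=> k0 k1 u us; exact: (vR_na (lk_s k0) (lk_sj k0) us (Ga_l _ _ _ _ k1) (lk_lj k1)).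
have szR s0 : size (R s0) = l2 s0 by rewrite size_route.
have par_R : odd (size (R s)) = odd (size (R s')) by rewrite !szR.
have Sx : x \in S by rewrite !inE eqxx orbT.
have Sx' : x' \in S by rewrite !inE eqxx !orbT.
have [Q QP] := diamond Dx Dx' Dt exx' (lk_path lk) (lk_path lk') (lk_lx lk) (lk_lx lk') (lk_lD lk)
  (lk_lD lk') (lkD _ _ _ _ lk) (lkD _ _ _ _ lk') (lkl _ _ _ _ _ _ _ _ lk lk')
  (lkl _ _ _ _ _ _ _ _ lk' lk) par_R (tS x Sx) (tS x' Sx') att.
have nW' : ~~ col W' n by apply: ncol_setD nC' (col_ball t).
pose M : {set G} := C :|: par @: W :|: [set gp w | w in W2].
have M_region u : u \in M -> u \in region C W.
  rewrite /region !in_setU; case/orP => [/orP[->//|/imsetP[w Ww ->]]|/imsetP[w W2w ->]].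
    have tw : par w \in tails W by apply/tailsP; exists 0, w; split.
    by rewrite tw orbT.
  have tw : gp w \in tails W by apply/tailsP; exists 1, w; split; rewrite ?(subsetP W2_W).
  by rewrite tw orbT.
have M_low u y' : u \in M -> y' \in low -> na u y'.
  rewrite in_setU => /orP[CUu|/imsetP[w W2w ->]] ylow.
    have [|Ku lu] := @Ga_lev u; first by rewrite in_setU CUu.
    by apply: low_na => //; left.
  have [Kg lg] := layer_iter (i := 2) (L_layer w W2w) isT.
  apply: low_na => //; right; split; first by rewrite lg; move: k5; clear; lia.
  have Ww := subsetP W2_W w W2w; rewrite naC.
  apply: (ball_na (i := 1) (j := 2) (st_ball st Ww)) => //; last exact: L_layer.
  have [|_ eg _] := lev_pos levK Kg0; first by move: k5 lg0; clear; lia.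
  by apply: edge_walk; rewrite edgeC.
have lkM x0 s0 m0 l0 : link x0 s0 m0 l0 -> {subset R s0 ++ [:: m0; l0] <= M}.
  move=> k0 u; rewrite mem_cat => /orP[us|].
    have [] := mem_R (lk_s k0) us; rewrite /Ga !in_setU in_set1 => /orP[->//|/eqP ->].
    by rewrite eqxx.
  rewrite !inE => /orP[] /eqP ->; [have := lk_m k0 | have := lk_l k0]; rewrite !in_setU => h //.
  by apply/orP; left.
have Dsub u : u \in D -> u \in M by move=> Du; rewrite !in_setU (subsetP D_C).
(* No vertex of the route touches what remains. For [C'] this follows from the distances from [v],
   [lk_mD] and [NS]. For the tails of [W'], the set [Bo s0] handles [R s0], and the ball around
   [m0], together with the levels from [z], handles [m0], [l0] and [x0]. *)
have avoid x0 s0 m0 l0 : link x0 s0 m0 l0 -> x0 \in D -> x0 \in S -> l0 \in S ->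
    (forall w, w \in W3 -> w \notin Bo s0 /\ w \notin ball m0) ->
    forall u y', u \in v :: R s0 ++ [:: m0; l0; x0] -> y' \in region C' W' -> na u y'.
  move=> k0 Dx0 Sx0 Sl0 W3s u y' uu.
  have [wl0 wx0] := lkm _ _ _ _ k0.
  have uE : [|| u \in v :: R s0, u == m0, u == l0 | u == x0].
    by move: uu; rewrite -cat_cons mem_cat !inE.
  have u_v_M : u = v \/ u \in M.
    case/or4P: uE => [|/eqP ->|/eqP ->|/eqP ->].
    - rewrite inE => /orP[/eqP ->|us]; first by left.
      by right; apply: (lkM _ _ _ _ k0); rewrite mem_cat us.
    - by right; apply: (lkM _ _ _ _ k0); rewrite mem_cat !inE eqxx orbT.
    - by right; apply: (lkM _ _ _ _ k0); rewrite mem_cat !inE eqxx !orbT.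
    - by right; apply: Dsub.
  rewrite /region in_setU => /orP[|ylow]; last first.
    case: u_v_M => [->|Mu]; last exact: M_low.
    by apply: low_na => //; [apply: (st_K st) | left; apply: (st_lev st)].
  rewrite in_setU => /orP[C'y'|].
    have [Dy' /NSP nSy'] := C'P y' C'y'.
    case/or4P: uE => [us|/eqP ->|/eqP ->|/eqP ->]; [|exact: lk_mD k0 _ Dy'|exact: nSy'|exact: nSy'].
    by apply: lkD k0 _ _ _ Dy'; rewrite -cat_cons mem_cat us.
  case/tailsP=> i [w [i3 /W'P[W3w _ _] ->]].
  have [W2w _ _ _ _] := W3P w W3w; have [nBo nb] := W3s w W3w; have Lw := L_layer w W2w.
  have far a : a \in K -> k <= (lev a).+1 -> i = 2 -> na a (iter i.+1 par w).
    move=> Ka la ->; have [Ki li] := layer_iter (i := 3) Lw isT.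
    by apply: (lev_na levK) => //; rewrite li; right; move: k5 la; clear; lia.
  case/or4P: uE => [us|/eqP ->|/eqP ->|/eqP ->].
  - exact: (vR_tails (lk_s k0) (lk_sj k0) us W2w nBo i3).
  - by apply: (ball_na (i := 0)) nb _ Lw _ => //; apply: eqxx.
  - have [Kl ll] := Ga_lev (Ga_l _ _ _ _ k0).
    have [i2|i2] := ltnP i 2; first exact: (ball_na nb wl0 Lw).
    by apply: far => //; move: i2 i3; clear; lia.
  - have [Kx lx] := layerP (D_layer x0 Dx0).
    have [i1|i1] := ltnP i 1; first exact: (ball_na nb wx0 Lw).
    have [|i2] := ltnP i 2; last by apply: far; rewrite ?lx //; move: i2 i3; clear; lia.
    move=> i2; have [Ki li] := layer_iter (i := i.+1) Lw (leqW i3).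
    by apply: (lev_na levK) => //; rewrite li lx; right; move: k5 i1 i2; clear; lia.
have av1 : forall u y', u \in v :: R s ++ [:: m; l; x] -> y' \in region C' W' -> na u y'.
  by apply: avoid lk Dx Sx _ _; [rewrite !inE eqxx | move=> w /W3P[]].
have av2 : forall u y', u \in v :: R s' ++ [:: m'; l'; x'] -> y' \in region C' W' -> na u y'.
  by apply: avoid lk' Dx' Sx' _ _; [rewrite !inE eqxx !orbT | move=> w /W3P[]].
exists t, C', W', Q; split => //; first by apply: D_ball.
  by move=> y' /C'P[Dy' _]; apply: D_ball.
move=> b; have [iQ lQ oQ sQ0] := QP b.
have sQ u : u \in belast v (Q b) ->
    u \in v :: R s ++ [:: m; l; x] \/ u \in v :: R s' ++ [:: m'; l'; x'].
  by move=> /sQ0 h; apply/orP; rewrite -mem_cat; exact: h.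
split => //.
  move=> u uQ; apply: M_region.
  have uv : u != v by have := ipath_uniq iQ; rewrite /= => /andP[nv _]; apply: contraNneq nv => <-.
  have : u \in rcons (belast v (Q b)) (last v (Q b)) by rewrite -lastI inE uQ orbT.
  rewrite mem_rcons inE lQ => /orP[/eqP ->|]; first exact: Dsub.
  have inM x0 s0 m0 l0 : link x0 s0 m0 l0 -> x0 \in D -> u \in v :: R s0 ++ [:: m0; l0; x0] -> u \in M.
    move=> k0 Dx0; rewrite inE (negbTE uv) /= -(cat1s m0) -(cat1s l0) !catA mem_cat -!catA /= mem_seq1.
    by case/orP => [/(lkM _ _ _ _ k0)//|/eqP ->]; apply: Dsub.
  by case/sQ; [exact: (inM _ _ _ _ lk Dx) | exact: (inM _ _ _ _ lk' Dx')].
by move=> u y' /sQ[]; [exact: av1 | exact: av2].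
Qed.

Lemma W2_Ga w : w \in W2 -> w \in Ga /\ l2 w = j.
Proof.
by move/(subsetP W2_D) => Dw; split; [apply/Ga_C/(subsetP D_C) | apply: D_j].
Qed.

(** Vertices of [W2] lie outside [ball v], while a route to one of them has [j] edges. Going back
    three steps from level [j] therefore does not reach [v]. *)
Lemma j_ge5 : 5 <= j.
Proof.
have [w W2w] : exists w, w \in W2 by apply: ncol_neq0 nW2; rewrite addnS.
have [Gw lw] := W2_Ga W2w; rewrite leqNgt.
apply: contra (D_ball (subsetP W2_D w W2w)) => j4; apply/ballP; exists j => //.
have := path_walk (ipath_path (ipath_route levG Gw erefl)).
by rewrite size_route (last_route levG Gw erefl) lw.
Qed.

(** Used when every route spoils little: [x] is reached along its own shortest route, with [s] three
    steps before [x]. *)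
Lemma link_levels x : x \in W2 -> link x (iter 3 p2 x) (iter 2 p2 x) (p2 x).
Proof.
move=> W2x; have [Gx lx] := W2_Ga W2x; have j5 := j_ge5.
have it i : i <= 3 -> iter i p2 x \in Ga /\ l2 (iter i p2 x) + i = j.
  move=> i3; have [|Gi li] := lev_iter levG (i := i) Gx; first by rewrite lx; move: i3 j5; clear; lia.
  by split; rewrite // li lx; move: i3 j5; clear; lia.
have [G1 l1] := it 1 isT; have [G2 l2_] := it 2 isT; have [G3 l3] := it 3 isT.
have CU y : y \in Ga -> 0 < l2 y -> y \in C :|: par @: W.
  rewrite /Ga in_setU in_set1 => /orP[//|/eqP -> y0].
  by move: y0; case: levG => ->.
have [|_ ex _] := lev_pos levG Gx; first by rewrite lx; move: j5; clear; lia.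
have nD i : 0 < i <= 3 -> iter i p2 x \notin D.
  move=> /andP[i0 i3]; have [Gi li] := it i i3; apply/negP => /D_j li'.
  by move: li i0; rewrite li' -{2}[j]addn0 => /addnI ->.
split => //.
- by rewrite l3.
- have -> : R (iter 3 p2 x) ++ [:: iter 2 p2 x; p2 x] = R (p2 x).
    have E1 : l2 (p2 x) = (l2 (iter 3 p2 x)).+2 by move: l1 l3 => /=; clear; lia.
    by rewrite /R E1 /= -!cats1 -catA.
  exact: (ipath_route levG G1 erefl).
- exact: (nD 1).
- by rewrite in_setU CU // ; move: l2_ j5; clear; lia.
- move=> d Dd; apply: (lev_na levG) => //; first by apply/Ga_C/(subsetP D_C).
  by left; rewrite (D_j Dd); move: l2_ => /=; clear; lia.
- by apply: CU => //; move: l1 j5 => /=; clear; lia.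
- by move: l1 => /=; clear; lia.
Qed.

(** The path leaves [R s] at the first vertex adjacent to the grandparent of [x], so no earlier
    vertex touches that grandparent; the parent of [x] is avoided by the distances from [v]. Cutting
    can only shrink the spoiled set, and the index of the cut determines the parity. *)
Lemma link_parent x s : s \in Ga -> l2 s + 3 <= j -> x \in Bo s ->
  exists y, [/\ link x y (gp x) (par x), Bo y \subset Bo s & l2 y = (find (e (gp x)) (R s)).+1].
Proof.
move=> Gs sj; rewrite inE => /andP[W2x hx].
have [y [Gy ey [ly ys] nh sub]] := route_find levG Gs erefl hx.
exists y; split => //; last first.
  apply/subsetP => w; rewrite !inE => /andP[-> /hasP[u uy eu]] /=.
  by apply/hasP; exists u => //; apply: sub.
have Wx := subsetP W2_W x W2x; have Lx := W_layer Wx.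
have yj : l2 y + 3 <= j by move: sj ys; clear; lia.
have [Gx lx] := W2_Ga W2x.
have [K1 lev1] := layer_iter (i := 1) Lx isT; have [K2 lev2] := layer_iter (i := 2) Lx isT.
have Rna u : u \in v :: R y -> na u (par x).
  by move=> uy; apply: vR_na uy _ _; rewrite ?Ga_par ?par_lev.
have lastR : last v (R y) = y by apply: (last_route levG).
have [|Gpy epy lpy] := lev_pos levG Gy; first by rewrite ly.
split => //.
- rewrite ipath_cat (ipath_route levG) // lastR /= edgeC ey (layer_edge (i := 1)) //=.
  apply/andP; split; first by rewrite Rna // -{1}lastR mem_last.
  have -> : R y = rcons (route p2 (l2 (p2 y)) (p2 y)) y by rewrite /R lpy.
  rewrite belast_rcons; apply/allP => u ur /=.
  have uy : u \in v :: R y.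
    by move: ur; rewrite !inE /R lpy /= mem_rcons inE => /orP[->//|->]; rewrite !orbT.
  rewrite Rna // !andbT; move: ur; rewrite inE => /orP[/eqP ->|ur].
    by apply: (st_tails st); apply/tailsP; exists 1, x; split.
  have [Gu _ _] := mem_R Gpy ur; have [Ku lu] := Ga_lev Gu.
  rewrite /na; apply/andP; split.
    by apply: contraTneq lu => ->; rewrite lev2; move: k5; clear; lia.
  apply: contra nh => eu; apply/hasP; exists u; rewrite ?lpy // edgeC //.
- exact: (layer_edge (i := 0)).
- apply/negP => /(subsetP D_C) /(subsetP (st_layer st)) /layerP[_].
  by rewrite lev1; move: k5; clear; lia.
- by rewrite in_setU imset_f ?orbT.
- move=> d /(subsetP D_C) /(subsetP (st_layer st)) /layerP[Kd ld].
  by apply: (lev_na levK) => //; left; rewrite lev2 ld; move: k5; clear; lia.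
- by rewrite in_setU imset_f ?orbT.
- exact: par_lev.
Qed.

Lemma step_exists : step_result.
Proof.
(* The 8 colours pay for the spoiled sets, 4 in total, and for the balls around [m] and [m']. *)
have nW2' : ~~ col W2 (n + 2 + 8) by rewrite -addnA.
pose bad i := [exists s in Ga, (l2 s == i) && ~~ col (Bo s) 2].
have [/existsP[i0 bi0]|nbad] := boolP [exists i : 'I_(j - 2), bad i].
  (* Here [i] is the first level with a spoiled set that is not 2-colourable, and [s] is a
     witness. *)
  have [|i /andP[ij /exists_inP[s Gs /andP[/eqP ls nBo]]] imin] :=
    @ex_minnP (fun i => (i + 3 <= j) && bad i).
    by exists i0; rewrite bi0 andbT; have := ltn_ord i0; have := j_ge5; clear; lia.
  have [w0] := ncol_neq0 (isT : 0 < 2) nBo; rewrite inE => /andP[_ hw0].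
  (* The route to [v] is empty and spoils nothing, so [s] has a predecessor. *)
  have s0 : 0 < l2 s by move: hw0; rewrite /R; case: (l2 s).
  have [Gp ep lp] := lev_pos levG Gs s0.
  have cBp : col (Bo (p2 s)) 2.
    apply: contraT => nB; have := imin (l2 (p2 s)).
    rewrite -ls lp ltnn => -> //; apply/andP; split; first by move: ij; rewrite -ls lp; clear; lia.
    by apply/exists_inP; exists (p2 s); rewrite ?eqxx.
  (* Passing from [p2 s] to [s] adds only vertices whose grandparent is adjacent to [s]. They are
     within distance 3 of [s], which costs two more colours. *)
  have cBs : col (Bo s) 4.
    apply: col_sub (col_setU cBp (col_ball s)); apply/subsetP => w.
    rewrite !in_setU inE => /andP[W2w]; rewrite /R lp /= has_rcons => /orP[ew|hw].
      apply/orP; right; apply/ballP; exists 3 => //.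
      have Lw := W_layer (subsetP W2_W w W2w).
      by apply: (@walk_cat 1 2 _ (gp w)); [apply: edge_walk; rewrite edgeC | apply/walk_sym/(walk_iter (i := 2))].
    by apply/orP; left; rewrite inE W2w.
  (* Splitting by the parity of the cut leaves an edge [x x'] inside one class, so its two routes
     have equal parity. *)
  have [b /ncol_edge[x [x' [+ + exx']]]] := ncol_class (fun w => odd (find (e (gp w)) (R s))) nBo.
  case/setIdP=> Bx /eqP px /setIdP[Bx' /eqP px'].
  have sj : l2 s + 3 <= j by rewrite ls.
  have [y [lk sub ly]] := link_parent Gs sj Bx; have [y' [lk' sub' ly']] := link_parent Gs sj Bx'.
  have BoD w : w \in Bo s -> w \in D by rewrite inE => /andP[/(subsetP W2_D)].
  apply: (@step_links x x' y y' _ _ _ _ (W2 :\: (Bo s :|: (ball (gp x) :|: ball (gp x')))) lk lk') => //.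
  - exact: BoD.
  - exact: BoD.
  - by rewrite ly ly' /= px px'.
  - by apply: setDS; apply: setSU; rewrite subUset sub sub'.
  - exact: ncol_setD nW2' (col_setU cBs (col_setU (col_ball _) (col_ball _))).
have cBo s : s \in Ga -> l2 s + 3 <= j -> col (Bo s) 2.
  move=> Gs sj; apply: contraR nbad => nB.
  have sj' : l2 s < j - 2 by move: sj; clear; lia.
  by apply/existsP; exists (Ordinal sj'); apply/exists_inP; exists s; rewrite /= ?eqxx.
(* No admissible route spoils much, so any edge of [W2] serves. *)
have nW21 : ~~ col W2 1 by apply: contra nW2; apply: col_leq; rewrite addnS.
have [x [x' [W2x W2x' exx']]] := ncol_edge nW21.
have lk := link_levels W2x; have lk' := link_levels W2x'.
have [G3 l3] := W2_Ga W2x; have [G3' l3'] := W2_Ga W2x'; have j5 := j_ge5.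
apply: (step_links lk lk' _ _ exx' _ (subxx _)); rewrite ?(subsetP W2_D) //.
  have [|_ ->] := lev_iter levG (i := 3) G3; first by rewrite l3; move: j5; clear; lia.
  have [|_ ->] := lev_iter levG (i := 3) G3'; first by rewrite l3'; move: j5; clear; lia.
  by rewrite l3 l3'.
have cB := cBo _ (lk_s lk) (lk_sj lk); have cB' := cBo _ (lk_s lk') (lk_sj lk').
exact: ncol_setD nW2' (col_setU (col_setU cB cB') (col_setU (col_ball _) (col_ball _))).
Qed.

End Step.
(** Two colours are spent on [ball v]. The component [D] is taken in a level of all of [C], not only
    of [W]; being connected, it can carry the next [C']. *)
Lemma step v C W n : state v C W -> ~~ col W (n + 12 + (n + 12)) -> step_result v C W n.
Proof.
move=> st nW; have [l2 [p2 levG]] := exists_levels (Ga_v v C W) (Ga_conn st).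
have [|j nj] := @ncol_level W l2 (n + 12) _ nW.
  move=> x y Wx Wy exy.
  have GaW w : w \in W -> w \in C :|: par @: W :|: [set v] by move/(subsetP (st_sub st))/Ga_C.
  by case: (lev_edge levG (GaW x Wx) (GaW y Wy) exy).
have nW1 : ~~ col ([set x in W | l2 x == j] :\: ball v) (n + 10).
  by apply: ncol_setD (col_ball v); rewrite -addnA.
have n0 : 0 < n + 10 by rewrite addnS.
have [|D [DA Dc _ nD]] := ncol_comp (A := [set x in C | l2 x == j] :\: ball v) n0 _ nW1.
  by apply: setSD; apply/subsetP => x; rewrite !inE => /andP[/(subsetP (st_sub st)) -> ->].
have DP d : d \in D -> [/\ d \in C, l2 d = j & d \notin ball v].
  by move/(subsetP DA); rewrite in_setD => /andP[db /setIdP[Cd /eqP dj]].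
apply: (step_exists st levG (j := j) (D := D) _ _ Dc _ _ _ nD).
- by apply/subsetP => d /DP[].
- by move=> d /DP[].
- by move=> d /DP[].
- by apply/subsetP => w; rewrite in_setI in_setD => /andP[/andP[_ /setIdP[]]].
- exact: subsetIr.
Qed.

(** * Closing the chain through the upper levels *)

Lemma par_g0 : [/\ par g0 \in K, e (par g0) g0 & lev (par g0) + 3 = k].
Proof.
have [|Kh eh lh] := lev_pos levK Kg0; first by move: k5 lg0; clear; lia.
by split=> //; move: lg0; rewrite lh; clear; lia.
Qed.

Lemma regionK v C W : state v C W -> region C W \subset K.
Proof.
move=> st; have [Kh _ _] := par_g0; apply/subsetP => y.
rewrite !in_setU in_set1 => /orP[/orP[/(subsetP (st_layer st))/layerP[]//|]|].
  by move=> /tailsP[i [w [i3 Ww ->]]]; case: (layer_iter (i := i.+1) (W_layer st Ww) (leqW i3)).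
by case/orP => [/setIdP[]|/eqP ->].
Qed.

(** [g0] has level [k - 2], so it differs by two levels from [C] and from [low] without [par g0];
    [st_ball] keeps it away from the tails. *)
Lemma region_g0 v C W y : state v C W -> y \in region C W -> y != par g0 -> na g0 y.
Proof.
move=> st + yh; rewrite !in_setU in_set1 (negbTE yh) orbF => /orP[/orP[Cy|]|].
- have [Ky ly] := layerP (subsetP (st_layer st) y Cy).
  by apply: (lev_na levK) => //; rewrite ly; left; move: lg0; clear; lia.
- move=> /tailsP[i [w [i3 Ww ->]]].
  apply: (ball_na (i := 0) (j := i.+1) (st_ball st Ww)) => //; first exact: eqxx.
  exact: W_layer st _ Ww.
- case/setIdP=> Ky ly.
  by apply: (lev_na levK) => //; right; move: lg0 ly; clear; lia.
Qed.

(** Everything is joined to the root [z]: the tails and [low] by following parents, and [C] by going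
    to [w] first. *)
Lemma region_conn v C W w : state v C W -> w \in W -> conn (region C W).
Proof.
move=> st Ww; have [Kh eh lh] := par_g0; set A := region C W.
have lowA y : y \in low -> y \in A by move=> h; rewrite /A /region in_setU h orbT.
have low_lev y : y \in K -> lev y + 4 <= k -> y \in low by move=> Ky ly; rewrite !inE Ky ly.
have upz m y : y \in K -> lev y = m -> m + 4 <= k -> connect (rin A) y z.
  elim: m y => [|m IH] y Ky ly mk; first by rewrite (lev0 levK Ky ly).
  have [|Kp ep lp] := lev_pos levK Ky; first by rewrite ly.
  have lp' : lev (par y) = m by move: lp; rewrite ly => -[].
  have mk' : m + 4 <= k by apply: leq_trans mk; rewrite addSn.
  apply: connect_trans (IH _ Kp lp' mk').
  by apply: rin_edge; rewrite 1?edgeC ?ep ?lowA ?low_lev ?ly ?lp'.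
have up y : y \in K -> lev y + 4 <= k -> connect (rin A) y z by move=> Ky; apply: upz Ky erefl.
have tailA w' i : w' \in W -> i < 3 -> iter i.+1 par w' \in A.
  move=> Ww' i3; rewrite /A /region !in_setU; have -> : iter i.+1 par w' \in tails W; last by rewrite orbT.
  by apply/tailsP; exists i, w'.
have CA c : c \in C -> c \in A by move=> Cc; rewrite /A /region !in_setU Cc.
have tailz u i : u \in W -> i < 4 -> connect (rin A) (iter i par u) z.
  move=> Wu i4; have Lw := W_layer st Wu.
  have [K4 l4] := layer_iter (i := 4) Lw isT.
  have l4k : lev (iter 4 par u) + 4 <= k by rewrite l4; move: k5; clear; lia.
  have c4 : connect (rin A) (iter 4 par u) z by apply: up.
  have step i' : i' < 4 -> connect (rin A) (iter i'.+1 par u) z -> connect (rin A) (iter i' par u) z.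
    move=> i4'; apply: connect_trans; apply: rin_edge.
    - case: i' i4' => [|i'] i4'; last by apply: tailA.
      by apply/CA/(subsetP (st_sub st)).
    - move: i4'; rewrite ltnS leq_eqVlt => /orP[/eqP ->|i3]; last exact: tailA.
      by apply/lowA/low_lev.
    - by rewrite edgeC; apply: layer_edge => //; apply: ltnW.
  have c3 := step 3 isT c4; have c2 := step 2 isT c3; have c1 := step 1 isT c2; have c0 := step 0 isT c1.
  by case: i i4 => [|[|[|[|i]]]].
have toz y : y \in A -> connect (rin A) y z.
  rewrite /A /region !in_setU in_set1 => /orP[/orP[Cy|/tailsP[i [u [i3 Wu ->]]]]|/orP[/setIdP[Ky ly]|/eqP ->]].
  - apply: connect_trans (tailz w 0 Ww isT); apply: (rinS (A := C)).
      by apply/subsetP.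
    by apply: (st_conn st) => //; apply: (subsetP (st_sub st)).
  - exact: tailz.
  - exact: up.
  - have [|Kp ep lp] := lev_pos levK Kh; first by move: lh k5; clear; lia.
    have lp4 : lev (par (par g0)) + 4 <= k by move: lh; rewrite lp; clear; lia.
    apply: connect_trans (up _ Kp lp4); apply: rin_edge; rewrite 1?edgeC ?ep //; last first.
      by apply/lowA/low_lev.
    by apply: lowA; rewrite in_setU in_set1 eqxx orbT.
by apply: (@conn_root _ z) => y /toz; rewrite rin_sym.
Qed.

Lemma state_low v C W y : state v C W -> y \in low -> na v y.
Proof. by move=> st ylow; apply: low_na => //; [apply: st_K st | left; apply: st_lev st]. Qed.

Lemma closing_path v C W : state v C W -> ~~ col W 1 ->
  exists p, [/\ ipath v p, last v p = par g0 & {subset p <= region C W}].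
Proof.
move=> st nW; have [w Ww] := ncol_neq0 (isT : 0 < 1) nW.
have [c Cc evc] := st_att st.
apply: (conn_ipath (c := c)) (region_conn st Ww) _ _ evc _.
- rewrite /region in_setU in_setU !negb_or (st_out st) /=; apply/andP; split; apply/negP => vt.
    by have := st_tails st vt; rewrite /na eqxx.
  by have := state_low st vt; rewrite /na eqxx.
- by rewrite !in_setU Cc.
- by rewrite !in_setU in_set1 eqxx !orbT.
Qed.

(* A step costs a factor 2 for the levels and six sets of 2 colours: the balls
   around [v], [t], [m], [m'] and the two sets [Bo]. *)
Fixpoint need r := if r is r'.+1 then need r' + 12 + (need r' + 12) else 1.

Definition concat (Q : nat -> bool -> seq G) r (h : nat -> bool) := flatten [seq Q i (h i) | i <- iota 0 r].

Lemma concatS Q r h :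
  concat Q r.+1 h = Q 0 (h 0) ++ concat (fun i => Q i.+1) r (fun i => h i.+1).
Proof. by rewrite /concat /= -[1]/(1 + 0) iotaDl -map_comp. Qed.

(** Each segment, except at its end, avoids the region kept for the sequel, and all later vertices
    stay in that region. Hence every choice of parities yields an induced path. *)
Lemma chain_exists r v C W : state v C W -> ~~ col W (need r) ->
  exists (q : nat -> G) (Q : nat -> bool -> seq G) (p : seq G),
  [/\ q 0 = v,
    forall i b, i < r -> [/\ ipath (q i) (Q i b), last (q i) (Q i b) = q i.+1 & odd (size (Q i b)) = b],
    forall h, [/\ ipath v (concat Q r h ++ p), last v (concat Q r h ++ p) = par g0 &
      {subset concat Q r h ++ p <= region C W}],
    forall i, 0 < i <= r -> q i \in C &
    forall i j, i < j <= r -> q j \notin ball (q i)].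
Proof.
elim: r v C W => [|r IH] v C W st nW.
  have [p [ip lp sp]] := closing_path st nW.
  exists (fun=> v), (fun=> fun=> [::]), p; split => //.
    by case=> [|i].
  by move=> i j /andP[ij]; rewrite leqn0 => /eqP j0; rewrite j0 in ij.
have [v' [C' [W' [Q0 [[st' C'C W'W Cv'] nW' bv' bC' QP]]]]] := step st nW.
have [q [Q [p [q0 qQ hp qC qb]]]] := IH v' C' W' st' nW'.
exists (fun i => if i is i'.+1 then q i' else v), (fun i => if i is i'.+1 then Q i' else Q0), p.
split => //.
- case=> [|i] b ib; last exact: qQ.
  by have [] := QP b; rewrite q0.
- move=> h; rewrite concatS -catA; have [iQ lQ _ sQ avQ] := QP (h 0).
  have [ip lp sp] := hp (fun i => h i.+1); split.
  + rewrite ipath_cat iQ lQ ip /=; apply/allP => u uQ; apply/allP => y /sp; exact: avQ.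
  + by rewrite last_cat lQ.
  + move=> u; rewrite mem_cat => /orP[/sQ//|/sp]; apply: (subsetP (regionS C'C W'W)).
- case=> [|[|i]] //= ir; first by rewrite q0.
  by apply: (subsetP C'C); apply: qC.
- case=> [|i] [|j] //= ij; last exact: qb.
  case: j ij => [|j] jr; first by rewrite q0.
  by apply: bC'; apply: qC.
Qed.

End Rope.
Lemma ring_exists X r : ~~ col X (need r + 2 + (need r + 2)) ->
  exists g h (q : nat -> G) (Q : nat -> bool -> seq G) (p : seq G),
  [/\ [/\ g \in X, e g (q 0), e h g, h != q 0 & forall i, i <= r -> q i \in X],
    forall i b, i < r -> [/\ ipath (q i) (Q i b), last (q i) (Q i b) = q i.+1 & odd (size (Q i b)) = b],
    forall f, [/\ ipath (q 0) (concat Q r f ++ p), last (q 0) (concat Q r f ++ p) = h &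
      {subset concat Q r f ++ p <= X}],
    forall f y, y \in concat Q r f ++ p -> y != h -> na g y &
    forall i j, i < j <= r -> q j \notin ball (q i)].
Proof.
set a := need r + 2 => nX; have a2 : 2 < a by rewrite /a; case: (r) => [|?] //=; rewrite !addnS.
have a0 : 0 < a by apply: leq_trans a2.
have aa : 0 < a + a by rewrite addn_gt0 a0.
have [K [KX cK _ nK]] := ncol_comp aa (subxx X) nX.
have {}nK : ~~ col K (a + a) by apply: contra nK; apply/col_sub/subsetIr.
have [z Kz] := ncol_neq0 aa nK.
have [lev [par levK]] := exists_levels Kz cK.
have [|k nk] := ncol_level (lev := lev) _ nK.
  by move=> x y Kx Ky exy; case: (lev_edge levK Kx Ky exy).
(* A level below 5 lies in the ball around [z], which is 2-colourable, while [a] exceeds 2. *)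
have k5 : 5 <= k.
  rewrite leqNgt; apply: contra nk => k4; apply: (col_leq (ltnW a2)); apply: col_sub (col_ball z).
  apply/subsetP => x /setIdP[Kx /eqP lx]; apply/ballP; exists k => //.
  have := path_walk (ipath_path (ipath_route levK Kx erefl)).
  by rewrite size_route (last_route levK Kx erefl) lx.
have [C [CL cC _ nC]] := ncol_comp a0 (subxx _) nk.
have {}nC : ~~ col C a by apply: contra nC; apply/col_sub/subsetIr.
have [w Cw] := ncol_neq0 a0 nC.
have Lw := subsetP CL w Cw.
have [K1 l1] := layer_iter levK k5 Lw (i := 1) isT.
have [K2 l2] := layer_iter levK k5 Lw (i := 2) isT.
have e1 := layer_edge levK k5 Lw (i := 0) isT; have e2 := layer_edge levK k5 Lw (i := 1) isT.
(* The chain starts at [u] and will close through [par g] and [g]; removing [ball g] from [C] keeps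
   the later tails away from [g]. *)
set u := par w in K1 l1 e1 e2; set g := par u in K2 l2 e2.
have lg : lev g + 2 = k by rewrite [lev g]l2; move: k5; clear; lia.
pose W := C :\: ball g.
have nW : ~~ col W (need r) by apply: ncol_setD nC (col_ball g).
have WC : W \subset C by apply: subsetDl.
have Wg x : x \in W -> x \notin ball g by rewrite in_setD => /andP[].
have WL x : x \in W -> x \in [set x in K | lev x == k] by move=> /(subsetP WC)/(subsetP CL).
have lu : lev u = k.-1 by rewrite [lev u]l1 subn1.
have st : state K lev par k g u C W.
  split=> //.
  - apply/negP => /(subsetP CL) /setIdP[_ /eqP]; rewrite lu; move: k5; clear; lia.
  - by exists w.
  - by rewrite lu; move: k5; clear; lia.
  - move=> _ /tailsP[i [x [i3 Wx ->]]].
    have [i2|i2] := ltnP i 2.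
      apply: (ball_na levK k5 (i := 1) (Wg x Wx) _ (WL x Wx)) => //.
      by apply: edge_walk.
    have [Ki li] := layer_iter levK k5 (WL x Wx) (i := i.+1) (leqW i3).
    by apply: (lev_na levK) => //; rewrite li lu; right; move: k5 i2 i3; clear; lia.
have [q [Q [p [q0 qQ hp qC qb]]]] := chain_exists levK k5 K2 lg st nW.
have [Kh eh lh] := par_g0 levK k5 K2 lg.
have CX c : c \in C -> c \in X by move=> /(subsetP CL)/setIdP[/(subsetP KX)].
exists g, (par g), q, Q, p; split => //.
- split; rewrite ?q0 //; first exact: (subsetP KX).
    by apply/eqP => E; move: lh; rewrite E lu; move: k5; clear; lia.
  case=> [_|i ir]; first by rewrite q0 (subsetP KX).
  by apply/CX/qC.
- move=> f; rewrite q0; have [ip lp sp] := hp f; split => // y /sp.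
  by move/(subsetP (regionK levK k5 K2 lg st))/(subsetP KX).
- by move=> f y yp; have [_ _ sp] := hp f; apply: (region_g0 levK k5 K2 lg st (sp _ yp)).
Qed.

(** * The ring *)

Definition steps x p := zip (x :: p) p.

Lemma steps_cat x p q : steps x (p ++ q) = steps x p ++ steps (last x p) q.
Proof. by elim: p x => //= y p IH x; rewrite /steps /= -/(steps y (p ++ q)) IH. Qed.

Lemma steps_edge x p a b : path e x p -> (a, b) \in steps x p -> [/\ e a b, a \in x :: p & b \in p].
Proof.
elim: p x => //= y p IH x /andP[exy pp]; rewrite /steps /= inE => /orP[/eqP[-> ->]|/(IH _ pp)[eab ay bp]].
  by rewrite exy !inE !eqxx.
by split; rewrite // inE ?bp ?ay orbT.
Qed.

Lemma ipath_steps x p a b : ipath x p -> a \in x :: p -> b \in x :: p -> e a b ->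
  (a, b) \in steps x p \/ (b, a) \in steps x p.
Proof.
elim: p x a b => [|y p IH] x a b /=.
  by rewrite !inE => _ /eqP -> /eqP ->; rewrite sedge_irrefl.
case/and3P=> exy nx ip; rewrite in_cons => /orP[/eqP ->|ap]; rewrite in_cons => /orP[/eqP ->|bp] eab.
- by rewrite sedge_irrefl in eab.
- left; move: bp; rewrite /steps /= inE => /orP[/eqP ->|bp]; first by rewrite inE eqxx.
  by have /andP[_] := allP nx b bp; rewrite eab.
- right; move: ap; rewrite /steps /= inE => /orP[/eqP ->|ap]; first by rewrite inE eqxx.
  by have /andP[_] := allP nx a ap; rewrite edgeC eab.
- by have [h|h] := IH y a b ip ap bp eab; [left | right]; rewrite /steps /= inE h orbT.
Qed.

(** The closed path [x :: c] ends at [x], so [c] alone lists the cycle, and the first step is the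
    one that wraps around from its last vertex. *)
Lemma steps_next x c a b : uniq c -> last x c = x -> ((a, b) \in steps x c) = (a \in c) && (b == next c a).
Proof.
case: c => [|y c] // uc lc; have sz : size (steps x (y :: c)) = (size c).+1.
  by rewrite /steps size_zip /= minnE subSnn subn1.
have nthS i : i < (size c).+1 ->
    nth (x, x) (steps x (y :: c)) i = (nth x [:: x, y & c] i, nth x (y :: c) i).
  by move=> ic; rewrite /steps nth_zip_cond -/(steps x (y :: c)) sz ic.
have xE : x = nth x (y :: c) (size c) by rewrite nth_last /= in lc *; rewrite -[in LHS]lc; case: (c) => //.
(* The default [y] of [nth] makes the first vertex the successor of the last one. *)
have nxt i : i <= size c -> next (y :: c) (nth x (y :: c) i) = nth y c i.
  by move=> ic; rewrite next_nth mem_nth // index_uniq.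
apply/idP/andP => [/(nthP (x, x))[i]|[/(nthP x)[i ic <-] /eqP ->]].
  rewrite sz => ic; rewrite nthS // => -[<- <-].
  case: i ic => [|i] ic.
    have := nxt _ (leqnn _); rewrite -xE nth_default //= => ->; split=> //.
    by rewrite xE mem_nth.
  have {}ic : i < size c by [].
  have E : nth x [:: x, y & c] i.+1 = nth x (y :: c) i by [].
  rewrite E (nxt i (ltnW ic)); split; first by apply: mem_nth; apply: leqW.
  by apply/eqP; rewrite /=; apply: set_nth_default.
have {}ic : i <= size c by [].
rewrite nxt //; move: ic; rewrite leq_eqVlt => /orP[/eqP ->|ic].
  by rewrite -xE nth_default // /steps /= inE eqxx.
have -> : (nth x (y :: c) i, nth y c i) = nth (x, x) (steps x (y :: c)) i.+1.
  by rewrite nthS //=; congr pair; apply: set_nth_default.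
by apply: mem_nth; rewrite sz.
Qed.

Lemma cycle_path_graph x y c : uniq (y :: c) -> last x (y :: c) = x ->
  cycle_graph (y :: c) = path_graph x (y :: c).
Proof.
move=> uc lc; rewrite /cycle_graph /path_graph; congr Subgraph.
  have xc : x \in y :: c by have := mem_last y c; move: lc => /= ->.
  by apply/setP => a; rewrite !inE; case: (eqVneq a x) => // ->; rewrite -in_cons xc.
apply/setP => E; apply/imsetP/imsetP => [[a ac ->]|[[a b] ab ->]].
  by exists (a, next (y :: c) a) => //; have := steps_next a (next (y :: c) a) uc lc; rewrite /steps ac eqxx.
move: ab; have := steps_next a b uc lc; rewrite /steps => -> /andP[ac /eqP ->].
by exists a.
Qed.

Lemma last_flatten r (q : nat -> G) (P : nat -> seq G) :
  (forall i, i < r -> last (q i) (P i) = q i.+1) -> last (q 0) (flatten [seq P i | i <- iota 0 r]) = q r.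
Proof.
elim: r => // r IH lP; rewrite -addn1 iotaD map_cat flatten_cat last_cat IH.
  by rewrite /= cats0 addn1 lP.
by move=> i ir; apply/lP/ltnW.
Qed.

Lemma eq_union_graph (I : finType) (H H' : I -> subgraph G) : H =1 H' -> union_graph H = union_graph H'.
Proof. by move=> HH; rewrite /union_graph; congr Subgraph; apply: eq_bigr => i _; rewrite HH. Qed.

Lemma union_path_graph r (q : nat -> G) (P : nat -> seq G) : 0 < r ->
  (forall i, i < r -> last (q i) (P i) = q i.+1) ->
  union_graph (fun i : 'I_r => path_graph (q i) (P i)) =
  path_graph (q 0) (flatten [seq P i | i <- iota 0 r]).
Proof.
move=> r0 lP; pose F n := flatten [seq P i | i <- iota 0 n].
have FS n : F n.+1 = F n ++ P n by rewrite /F -addn1 iotaD map_cat flatten_cat /= cats0.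
have lF n : n <= r -> last (q 0) (F n) = q n.
  by move=> nr; apply: last_flatten => i ir; apply: lP; apply: leq_trans nr.
have sF n : n <= r -> steps (q 0) (F n) = flatten [seq steps (q i) (P i) | i <- iota 0 n].
  elim: n => // n IH nr; rewrite FS steps_cat lF ?IH 1?ltnW //.
  by rewrite -addn1 iotaD map_cat flatten_cat /= cats0.
(* For [n = 0] the left side would still contain [q 0]. Each later start is already the last vertex
   of the preceding piece. *)
have vF n : 0 < n <= r -> q 0 :: F n =i flatten [seq q i :: P i | i <- iota 0 n].
  elim: n => // -[|n] IH nr x; first by rewrite /F /= cats0.
  have nr' : n.+1 <= r by case/andP: nr => _ /ltnW.
  have : q n.+1 \in flatten [seq q i :: P i | i <- iota 0 n.+1] by rewrite -(IH nr') -(lF _ nr') mem_last.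
  rewrite -[in RHS](addn1 n.+1) iotaD map_cat flatten_cat.
  move: (flatten [seq q i :: P i | i <- iota 0 n.+1]) (IH nr') => L IHL qL.
  rewrite FS -cat_cons mem_cat IHL [in RHS]mem_cat.
  by rewrite /= cats0 in_cons; case: eqVneq => [->|]; rewrite ?qL ?orbT.
rewrite /union_graph /path_graph; congr Subgraph; apply/setP => x.
  rewrite inE vF ?r0 /=; last exact: leqnn.
  apply/bigcupP/flatten_mapP => [[i _]|[i]].
    by rewrite inE => xi; exists (val i); rewrite ?mem_iota /=.
  by rewrite mem_iota => /andP[_ ir] xi; exists (Ordinal ir); rewrite ?inE.
have stE : zip (q 0 :: F r) (F r) = flatten [seq steps (q i) (P i) | i <- iota 0 r] by apply: sF.
apply/bigcupP/imsetP => [[i _ /imsetP[uv uvi ->]]|[uv]].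
  exists uv => //; rewrite -/(F r) stE; apply/flatten_mapP; exists (val i) => //.
  by rewrite mem_iota /=.
rewrite -/(F r) stE => /flatten_mapP[i]; rewrite mem_iota => /andP[_ ir] uvi ->.
by exists (Ordinal ir) => //; apply/imsetP; exists uv.
Qed.

(** The path has no chords, and [g] touches it only at its two ends. As [h != u], the cycle has at
    least three vertices. *)
Lemma ring_induced_cycle u p g h : ipath u p -> last u p = h -> h != u -> e h g -> e g u ->
  (forall y, y \in p -> y != h -> na g y) ->
  [/\ path e u (p ++ [:: g; u]), uniq (p ++ [:: g; u]) &
    is_induced_cycle (path_graph u (p ++ [:: g; u]))].
Proof.
move=> ip lp hu ehg egu gna; set c := p ++ [:: g; u].
have pc : path e u c by rewrite cat_path (ipath_path ip) lp /= ehg egu.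
have up := ipath_uniq ip; have gp : g \notin u :: p.
  rewrite inE negb_or edge_neq //=; apply/negP => gp.
  have [gh|gh] := eqVneq g h; first by rewrite gh sedge_irrefl in ehg.
  by have := gna g gp gh; rewrite /na eqxx.
have uc : uniq c.
  move: up gp; rewrite /c cat_uniq /= !inE negb_or => /andP[up ->] /andP[gu gp].
  by rewrite (negbTE gp) (negbTE up) gu.
have memc y : (y \in c) = (y == g) || (y \in u :: p).
  by rewrite mem_cat !inE; case: (y \in p); case: (y == g); case: (y == u).
have lc : last u c = u by rewrite /c last_cat.
have sc : steps u c = steps u p ++ [:: (h, g); (g, u)] by rewrite steps_cat lp.
have gstep y : y \in u :: p -> e g y -> (y, g) \in steps u c \/ (g, y) \in steps u c.
  move=> yp egy; rewrite sc !mem_cat !inE.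
  have [->|yu] := eqVneq y u; first by right; rewrite eqxx !orbT.
  have [->|yh] := eqVneq y h; first by left; rewrite eqxx !orbT.
  move: yp; rewrite inE (negbTE yu) => /gna/(_ yh).
  by rewrite /na egy andbF.
have adj a b : a \in c -> b \in c -> e a b -> (a, b) \in steps u c \/ (b, a) \in steps u c.
  rewrite !memc => /predU1P[->|ap] /predU1P[->|bp] eab.
  - by rewrite sedge_irrefl in eab.
  - by case: (gstep b bp eab); [right | left].
  - by apply: gstep; rewrite // edgeC.
  - by rewrite sc !mem_cat; case: (ipath_steps ip ap bp eab) => ->; [left | right].
have [y0 [c0 c0E]] : exists y0 c0, c = y0 :: c0.
  by rewrite /c; case: (p) => [|y0 p0]; eexists; eexists; reflexivity.
have uc0 : u \in c by rewrite memc inE eqxx orbT.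
split=> //; split.
  exists c; last by move: uc lc; rewrite c0E => uc' lc'; rewrite (cycle_path_graph uc' lc').
  rewrite /is_cycle /ucycleb (cycle_path u) lc pc uc !andbT /c size_cat /=.
  case: (p) lp => [/= E|y1 p1 _]; first by rewrite E eqxx in hu.
  by rewrite /= !addnS.
have vE y : (y \in sub_vertices (path_graph u c)) = (y \in c).
  by rewrite inE in_cons; case: eqVneq => // ->; rewrite uc0.
apply/setP => E; apply/imsetP/imset2P => [[[a b] ab ->]|[a b]].
  have [eab ac bc] := steps_edge pc ab.
  exists a b => //; first by rewrite vE; move: ac; rewrite in_cons => /predU1P[->|].
  by apply/setIdP; rewrite vE.
rewrite vE => ac /setIdP[]; rewrite vE => bc eab ->.
by case: (adj a b ac bc eab) => h'; [exists (a, b) | exists (b, a) => //=; rewrite setUC].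
Qed.

Lemma ball_sym x y : (x \in ball y) = (y \in ball x).
Proof. by apply/ballP/ballP => [] [n n4 w]; exists n; rewrite // walk_sym. Qed.

Lemma concat_last Q r f : concat Q r.+1 f = concat Q r f ++ Q r (f r).
Proof. by rewrite /concat -addn1 iotaD map_cat flatten_cat /= cats0. Qed.

(** A chain of [r] segments has [r + 1] ends. The last one becomes an inner vertex of the last path
    of the rope; the others are the rope vertices. *)
Lemma rope_exists X r : 0 < r -> ~~ col X (need r + 2 + (need r + 2)) ->
  exists (q : 'I_r -> G) (Q : 'I_r -> bool -> seq G), arithmetic_rope q Q /\ rope_within X q Q.
Proof.
case: r => // r _ nX.
have [g [h [q [Q [p [[Xg egq ehg hq Xq] qQ ipQ gna qb]]]]]] := ring_exists nX.
pose d := odd (size p).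
(* The last segment absorbs the closing path; [d] corrects its parity. *)
pose P i b := if i == r then Q i (b (+) d) ++ p ++ [:: g; q 0] else Q i b.
pose F (f : nat -> bool) i := if i == r then f i (+) d else f i.
have concatP f : flatten [seq P i (f i) | i <- iota 0 r.+1] =
    (concat Q r.+1 (F f) ++ p) ++ [:: g; q 0].
  rewrite -/(concat P r.+1 f) !concat_last {2}/P {2}/F eqxx -!catA; congr (_ ++ _).
  rewrite /concat; congr flatten; apply/eq_in_map => i.
  by rewrite mem_iota add0n /P /F => /andP[_ /ltn_eqF ->].
have ring f : [/\ path e (q 0) ((concat Q r.+1 (F f) ++ p) ++ [:: g; q 0]),
    uniq ((concat Q r.+1 (F f) ++ p) ++ [:: g; q 0]) &
    is_induced_cycle (path_graph (q 0) ((concat Q r.+1 (F f) ++ p) ++ [:: g; q 0]))].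
  have [ip lp _] := ipQ (F f).
  by apply: ring_induced_cycle ip lp hq ehg egq _ => y; apply: gna.
(* [q'] replaces the last end of the chain by [q 0], so that the paths [P] close up cyclically. *)
pose q' i := if i == r.+1 then q 0 else q i.
have q'E i : i <= r -> q' i = q i by rewrite /q' => ir; rewrite ltn_eqF.
have lP f i : i < r.+1 -> last (q' i) (P i (f i)) = q' i.+1.
  move=> ir; rewrite q'E // /P /q' eqSS; case: eqP => [_|_].
    by rewrite !last_cat.
  by have [_ ->] := qQ i (f i) ir.
have q'S (i : 'I_r.+1) : q' i.+1 = q (ordS i).
  rewrite /q' /= eqSS; have := ltn_ord i; rewrite ltnS leq_eqVlt => /orP[/eqP ->|ir].
    by rewrite eqxx modnn.
  by rewrite ltn_eqF // modn_small.
have sub_c i b : i < r.+1 -> {subset P i b <= (concat Q r.+1 (F (fun=> b)) ++ p) ++ [:: g; q 0]}.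
  move=> ir y yP; rewrite -concatP; apply/flatten_mapP; exists i; rewrite ?mem_iota //.
have lastP f : last (q 0) (concat P r f) = q r.
  rewrite /concat -(q'E r (leqnn r)) -(q'E 0 (leq0n r)).
  by apply: (last_flatten (q := q')) => i ir; apply: (lP f); apply: ltnW.
(* With a single segment the path returns to its start, so only the listing without the start is
   free of repetitions. *)
have uP i b : i < r.+1 -> uniq (P i b) /\ (0 < r -> uniq (q i :: P i b)).
  move=> ir; have [_ uc _] := ring (fun=> b).
  have [ip lp _] := ipQ (F (fun=> b)).
  have [Ei|ni] := eqVneq i r; last first.
    have [iQ _ _] := qQ i b ir; rewrite /P (negbTE ni).
    by have := ipath_uniq iQ; split => //; case/andP: (ipath_uniq iQ).
  move: uc; rewrite -concatP -/(concat P r.+1 (fun=> b)) concat_last cat_uniq Ei => /and3P[_ nh uPi].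
  split=> // r0; rewrite cons_uniq uPi andbT; apply: contra nh => qP; apply/hasP; exists (q r) => //.
  have := mem_last (q 0) (concat P r (fun=> b)); rewrite lastP inE => /orP[/eqP E|//].
  by have := qb 0 r; rewrite E r0 leqnSn => /(_ isT) /negP[]; apply/ballP; exists 0; rewrite /= ?eqxx.
have eP i b : i < r.+1 -> path e (q i) (P i b).
  move=> ir; have [Ei|ni] := eqVneq i r; last first.
    by have [/ipath_path] := qQ i b ir; rewrite /P (negbTE ni).
  have [pc _ _] := ring (fun=> b).
  by move: pc; rewrite -concatP -/(concat P r.+1 (fun=> b)) concat_last cat_path lastP Ei => /andP[].
exists (fun i : 'I_r.+1 => q i), (fun (i : 'I_r.+1) b => P i b); split; [split|].
- move=> i b; split.
    have ir := ltn_ord i; have [u1 u2] := uP i b ir.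
    rewrite /is_path eP //= -[in last _ _ == _]q'S -(lP (fun=> b)) // q'E // eqxx /=.
    case: eqP => // ne; apply: u2; rewrite lt0n; apply/eqP => r0; apply: ne; congr q.
    by move: (i) ir => [j ij] /=; rewrite r0 modn1; case: j ij => // j; rewrite r0.
  rewrite /P; case: eqP => [->|ne]; last by have [] := qQ i b (ltn_ord i).
  have [_ _ oQ] := qQ r (b (+) d) (ltnSn r).
  by rewrite !size_cat /= !oddD oQ /= -/d addbF addbK.
- move=> f; pose f' i := f (inord i).
  have [_ _] := ring f'; rewrite -concatP.
  rewrite -(union_path_graph (q := q') (P := fun i => P i (f' i))) //; last by move=> i; apply: (lP f').
  rewrite (@eq_union_graph _ _ (fun i : 'I_r.+1 => path_graph (q i) (P i (f i)))) // => i.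
  by rewrite /f' inord_val q'E // -ltnS.
- move=> i j ij; apply: dist_ball; case: (ltngtP i j) => [lt|lt|/val_inj E]; last by rewrite E eqxx in ij.
    by apply: qb; rewrite lt ltnW.
  by rewrite ball_sym; apply: qb; rewrite lt ltnW.
- move=> i; split; first by apply: Xq; apply: ltnW.
  move=> b y /(sub_c i b (ltn_ord i)); have [_ _ sX] := ipQ (F (fun=> b)).
  by rewrite mem_cat !inE => /or3P[/sX//|/eqP ->//|/eqP ->]; apply: Xq.
Qed.

End Graph.

(** * The chromatic number and the numerical bound *)

Lemma col_induced (G : sgraph) (X : {set G}) k : col X k -> chi (induced X) <= k.
Proof.
case/colP=> f fP; rewrite /chi; case: ex_minnP => n _; apply.
apply/existsP; exists [ffun x => f (val x)]; apply/'forall_forallP => x y.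
by apply/implyP => exy; rewrite !ffunE; apply: fP; rewrite ?(valP x) ?(valP y).
Qed.

Lemma needE r : need r + 24 = 25 * 2 ^ r.
Proof. by elim: r => // r IH; rewrite /= expnS; lia. Qed.

(** This makes the final comparison linear in [2 ^ r] and [6 ^ r]; both inequalities are equalities
    at [r = 1]. *)
Lemma pow6_ge r : 0 < r -> 9 * 2 ^ r <= 6 ^ r + 12 /\ 2 <= 2 ^ r.
Proof.
case: r => // r _; elim: r => // r [IH1 IH2]; rewrite expnS [6 ^ _]expnS; lia.
Qed.

Import Order.TTheory GRing.Theory Num.Theory.
Local Open Scope ring_scope.

Theorem theorem4p1 (r : nat) (G : sgraph) (X : {set G})
  (r_gt0 : (0 < r)%N)
  (girthG : odd_girth_at_least G 11)
  (chiX : 6 ^+ r.+1 + 34 / 5 * (6 ^+ r - 1) - 1 <= (chi (induced X))%:R :> rat) :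
  exists (q : 'I_r -> G) (Q : 'I_r -> bool -> seq G),
    arithmetic_rope q Q /\ rope_within X q Q.
Proof.
apply: (rope_exists girthG r_gt0); apply/negP => /col_induced chi_le.
have [p6 p2] := pow6_ge r_gt0; have nE := needE r.
(* A failure would bound the chromatic number by [2 * (need r + 2)], which equals
   [50 * 2 ^ r - 44]. *)
have [a b] : (chi (induced X) + 44 <= 50 * 2 ^ r)%N /\ (9 * 2 ^ r <= 6 ^ r + 12)%N.
  by split=> //; move: chi_le nE; clear; lia.
have {}a : (chi (induced X))%:R + 44 <= 50 * 2 ^+ r :> rat.
  by move: a; rewrite -(ler_nat rat) natrD natrM natrX.
have {}b : 9 * 2 ^+ r <= 6 ^+ r + 12 :> rat.
  by move: b; rewrite -(ler_nat rat) natrD natrM !natrX.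
have {}p2 : 2 <= 2 ^+ r :> rat by move: p2; rewrite -(ler_nat rat) natrX.
move: chiX a b p2; rewrite exprS.
by move: (6 ^+ r : rat) (2 ^+ r : rat) ((chi _)%:R : rat) => x y c; clear; lra.
Qed.
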